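(* Let $G$ be a cosimplicial groupoid and let $j: G \to H$ be a stack completion of $G$. Then the maps $$\mathbf{hom}(\Delta,BG) \xrightarrow{j_{\ast}} \mathbf{hom}(\Delta,BH) \longleftarrow \mathbf{hom}(\ast,BH)$$ induced by $j$ and by $\Delta\to\ast$ are weak equivalences of simplicial sets. Thus the groupoid $G^{\mathbf{\Delta}}$ is equivalent to the groupoid of global sections $\varprojlim_{\mathbf{n}} H^{n}$ of the stack completion of $G$.
   Context: $\mathbf{\Delta}$ is the category of finite ordinals $\mathbf{n}=\{0,1,\dots,n\}$, $n\ge 0$, and order-preserving functions. A cosimplicial groupoid is a functor $G$ from $\mathbf{\Delta}$ to groupoids, $G^n=G(\mathbf{n})$; a cosimplicial space is a functor from $\mathbf{\Delta}$ to simplicial sets; $\ast$ is the terminal cosimplicial space. The injective model structure on cosimplicial spaces has as weak equivalences (resp. cofibrations) the maps $X\to Y$ such that each $X^n\to Y^n$ is a weak equivalence (resp. monomorphism) of simplicial sets; injective fibrations are the maps with the right lifting property with respect to trivial cofibrations. $BG$ is the cosimplicial space $\mathbf{n}\mapsto B(G^n)$, where $B$ is the nerve. A map $G\to H$ of cosimplicial groupoids is a weak equivalence if $BG\to BH$ is a weak equivalence of cosimplicial spaces. A cosimplicial groupoid $H$ is a stack if $BH$ is injective fibrant. A stack completion of $G$ is a weak equivalence $G\to H$ of cosimplicial groupoids such that $H$ is a stack. $\Delta$ is the cosimplicial space $\mathbf{n}\mapsto\Delta^n$, and $\mathbf{hom}(X,Y)$ is the simplicial set whose $n$-simplices are the cosimplicial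 space maps $X\times\Delta^n\to Y$. $G^{\mathbf{\Delta}}$ is the groupoid whose objects are the maps of cosimplicial categories $\mathbf{\Delta}\to G$ (where $\mathbf{\Delta}$ here denotes the cosimplicial category $\mathbf{n}\mapsto\mathbf{n}$) and whose morphisms are natural transformations of these; its nerve is $\mathbf{hom}(\Delta,BG)$. The nerve of the groupoid of global sections $\varprojlim_{\mathbf{n}}H^n$ is $\mathbf{hom}(\ast,BH)$. *)

(* Defs.v *)
From mathcomp Require Import all_boot boolp.

Set Implicit Arguments.
Unset Strict Implicit.
Unset Printing Implicit Defensive.

#[local] Obligation Tactic := intros; simpl.

Record category := Category {
  cat_ob :> Type;
  hom : cat_ob -> cat_ob -> Type;
  idm : forall x, hom x x;
  comp : forall x y z, hom y z -> hom x y -> hom x z;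
  comp_idl : forall x y (f : hom x y), comp (idm y) f = f;
  comp_idr : forall x y (f : hom x y), comp f (idm x) = f;
  comp_assoc : forall x y z t (h : hom z t) (g : hom y z) (f : hom x y),
    comp h (comp g f) = comp (comp h g) f }.

Arguments hom {c} x y.
Arguments idm {c} x.
Arguments comp {c x y z} g f.

Record inverses (C : category) := Inverses {
  inv : forall x y : C, hom x y -> hom y x;
  comp_invl : forall (x y : C) (f : hom x y), comp (inv f) f = idm x;
  comp_invr : forall (x y : C) (f : hom x y), comp f (inv f) = idm y }.

Record groupoid := Groupoid {
  gpd_cat :> category;
  gpd_inv : inverses gpd_cat }.

Record functor (C D : category) := Functor {
  fob :> C -> D;
  fmap : forall x y, hom x y -> hom (fob x) (fob y);
  fmap_id : forall x, fmap (idm x) = idm (fob x);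
  fmap_comp : forall x y z (g : hom y z) (f : hom x y),
    fmap (comp g f) = comp (fmap g) (fmap f) }.

Arguments fmap {C D} F {x y} f : rename.

Definition fid (C : category) : functor C C :=
  @Functor C C id (fun _ _ f => f) (fun _ => erefl) (fun _ _ _ _ _ => erefl).

Program Definition fcomp (C D E : category) (G : functor D E) (F : functor C D)
  : functor C E :=
  @Functor C E (fun x => G (F x)) (fun _ _ f => fmap G (fmap F f)) _ _.
Next Obligation. by rewrite !fmap_id. Qed.
Next Obligation. by rewrite !fmap_comp. Qed.

Record nattrans (C D : category) (F G : functor C D) := Nattrans {
  ncomp :> forall x, hom (F x) (G x);
  ncompP : forall x y (f : hom x y),
    comp (ncomp y) (fmap F f) = comp (fmap G f) (ncomp x) }.

Definition is_iso (C : category) (x y : C) (f : hom x y) :=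
  exists g : hom y x, comp g f = idm x /\ comp f g = idm y.

Definition nat_isomorphic (C D : category) (F G : functor C D) :=
  exists a : nattrans F G, forall x, is_iso (a x).

Definition equivalent (C D : category) :=
  exists (F : functor C D) (G : functor D C),
    nat_isomorphic (fid C) (fcomp G F) /\ nat_isomorphic (fcomp F G) (fid D).

(** The set of all morphisms of a category. An equation [Arrow f = Arrow g]
    says that [f] and [g] have equal sources and targets and are equal; it is
    used when those equalities are not definitional. *)
Record arrow (C : category) := Arrow {
  src : C; tgt : C; arr : hom src tgt }.

Arguments Arrow {C src tgt} arr.

Lemma arrowE (C : category) (x y x' y' : C) (f : hom x y) (f' : hom x' y') :
  Arrow f = Arrow f' ->
  exists (ex : x = x') (ey : y = y'),
    f' = ecast b (hom x' b) ey (ecast a (hom a y) ex f).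
Proof.
move=> e; pose A := Arrow f; pose B := Arrow f'; rewrite -/A -/B in e.
suff: exists (ex : src A = src B) (ey : tgt A = tgt B),
    arr B = ecast b (hom (src B) b) ey (ecast a (hom a (tgt A)) ex (arr A)).
  by [].
by rewrite -e; exists erefl, erefl.
Qed.

Lemma arrow_inj (C : category) (x y : C) (f g : hom x y) :
  Arrow f = Arrow g -> f = g.
Proof.
case/arrowE=> ex [ey ->].
by rewrite (Prop_irrelevance ex erefl) (Prop_irrelevance ey erefl).
Qed.

Lemma arrow_comp (C : category) (x y z x' y' z' : C)
    (g : hom y z) (f : hom x y) (g' : hom y' z') (f' : hom x' y') :
  Arrow f = Arrow f' -> Arrow g = Arrow g' ->
  Arrow (comp g f) = Arrow (comp g' f').
Proof.
case/arrowE=> ex [ey ->]; case/arrowE=> ey' [ez ->].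
by rewrite (Prop_irrelevance ey' ey); case: _ / ex; case: _ / ez; case: _ / ey.
Qed.

Lemma arrow_inv (C : category) (i : inverses C) (x y x' y' : C)
    (f : hom x y) (f' : hom x' y') :
  Arrow f = Arrow f' -> Arrow (inv i f) = Arrow (inv i f').
Proof. by case/arrowE=> ex [ey ->]; case: _ / ex; case: _ / ey. Qed.

Lemma functor_eq (C D : category) (F G : functor C D) :
  (forall x, F x = G x) ->
  (forall x y (f : hom x y), Arrow (fmap F f) = Arrow (fmap G f)) -> F = G.
Proof.
case: F => Fo Fm Fi Fc; case: G => Go Gm Gi Gc /= eo.
have {}eo : Fo = Go by apply: functional_extensionality_dep.
subst Go => em; have {}em : Fm = Gm.
  do 3![apply: functional_extensionality_dep => ?]; exact: arrow_inj.
by subst Gm; rewrite (Prop_irrelevance Fi Gi) (Prop_irrelevance Fc Gc).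
Qed.

Lemma nattrans_eq (C D : category) (F G : functor C D) (a b : nattrans F G) :
  (forall x, a x = b x) -> a = b.
Proof.
case: a => a ea; case: b => b eb /= e.
have {}e : a = b by apply: functional_extensionality_dep.
by subst b; rewrite (Prop_irrelevance ea eb).
Qed.

Program Definition nid (C D : category) (F : functor C D) : nattrans F F :=
  @Nattrans C D F F (fun x => idm (F x)) _.
Next Obligation. by rewrite comp_idl comp_idr. Qed.

Program Definition nvcomp (C D : category) (F G H : functor C D)
    (b : nattrans G H) (a : nattrans F G) : nattrans F H :=
  @Nattrans C D F H (fun x => comp (b x) (a x)) _.
Next Obligation. by rewrite -comp_assoc ncompP !comp_assoc ncompP. Qed.

Program Definition ninv (C D : category) (i : inverses D) (F G : functor C D)
    (a : nattrans F G) : nattrans G F :=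
  @Nattrans C D G F (fun x => inv i (a x)) _.
Next Obligation.
rewrite -[LHS]comp_idr -(comp_invr i (a x)) -comp_assoc (comp_assoc (fmap G f)).
by rewrite -ncompP !comp_assoc comp_invl comp_idl.
Qed.

(** The finite ordinal [n] = {0,...,n} is encoded by the natural number n and has
    underlying type ['I_n.+1]. *)

Record smap (m n : nat) := Smap {
  sfun :> 'I_m.+1 -> 'I_n.+1;
  sfun_homo : {homo sfun : i j / (i <= j)%N} }.

Lemma smap_eq m n (t u : smap m n) : (forall i, t i = u i) -> t = u.
Proof.
case: t => t ht; case: u => u hu /= e; have {}e : t = u by apply: funext.
by subst u; rewrite (Prop_irrelevance ht hu).
Qed.

Definition sid n : smap n n := @Smap n n id (fun _ _ le_ij => le_ij).

Definition scomp l m n (t : smap m n) (u : smap l m) : smap l n :=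
  @Smap l n (fun i => t (u i)) (fun i j le_ij => sfun_homo t (sfun_homo u le_ij)).

Definition sconst m n (i : 'I_n.+1) : smap m n :=
  @Smap m n (fun _ => i) (fun _ _ _ => leqnn i).

Program Definition ordcat (n : nat) : category :=
  @Category 'I_n.+1 (fun i j => (i <= j)%N) (fun i => leqnn i)
    (fun _ _ _ g f => leq_trans f g) _ _ _.
Next Obligation. exact: bool_irrelevance. Qed.
Next Obligation. exact: bool_irrelevance. Qed.
Next Obligation. exact: bool_irrelevance. Qed.

Program Definition ordmap m n (t : smap m n) : functor (ordcat m) (ordcat n) :=
  @Functor (ordcat m) (ordcat n) t (fun i j => @sfun_homo m n t i j) _ _.
Next Obligation. exact: bool_irrelevance. Qed.
Next Obligation. exact: bool_irrelevance. Qed.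

Lemma ordmap_id n : ordmap (sid n) = fid (ordcat n).
Proof. by apply: functor_eq. Qed.

Lemma ordmap_comp l m n (t : smap m n) (u : smap l m) :
  ordmap (scomp t u) = fcomp (ordmap t) (ordmap u).
Proof.
by apply: functor_eq => // x y f; congr Arrow; apply: bool_irrelevance.
Qed.

Record sset := SSet {
  simp :> nat -> Type;
  sact : forall m n, smap m n -> simp n -> simp m;
  sact_id : forall n (x : simp n), sact (sid n) x = x;
  sact_comp : forall l m n (t : smap m n) (u : smap l m) (x : simp n),
    sact (scomp t u) x = sact u (sact t x) }.

Arguments sact {s m n} t x.

Record sset_map (X Y : sset) := SSetMap {
  smap_fun :> forall n, X n -> Y n;
  smap_nat : forall m n (t : smap m n) (x : X n),
    smap_fun (sact t x) = sact t (smap_fun x) }.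

Arguments smap_fun {X Y} s n x.

Lemma sset_map_eq (X Y : sset) (f g : sset_map X Y) :
  (forall n x, f n x = g n x) -> f = g.
Proof.
case: f => f ef; case: g => g eg /= e.
have {}e : f = g by do 2![apply: functional_extensionality_dep => ?].
by subst g; rewrite (Prop_irrelevance ef eg).
Qed.

Definition ssid (X : sset) : sset_map X X :=
  @SSetMap X X (fun _ x => x) (fun _ _ _ _ => erefl).

Program Definition sscomp (X Y Z : sset) (g : sset_map Y Z) (f : sset_map X Y)
  : sset_map X Z :=
  @SSetMap X Z (fun n x => g n (f n x)) _.
Next Obligation. by rewrite !smap_nat. Qed.

Lemma sscompA (X Y Z W : sset) (h : sset_map Z W) (g : sset_map Y Z)
    (f : sset_map X Y) : sscomp h (sscomp g f) = sscomp (sscomp h g) f.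
Proof. exact: sset_map_eq. Qed.

Program Definition ssprod (X Y : sset) : sset :=
  @SSet (fun n => (X n * Y n)%type)
    (fun _ _ t x => (sact t x.1, sact t x.2)) _ _.
Next Obligation. by case: x => a b; rewrite /= !sact_id. Qed.
Next Obligation. by rewrite !sact_comp. Qed.

Program Definition sspair (X Y Z : sset) (f : sset_map X Y) (g : sset_map X Z)
  : sset_map X (ssprod Y Z) :=
  @SSetMap X (ssprod Y Z) (fun n x => (f n x, g n x)) _.
Next Obligation. by rewrite !smap_nat. Qed.

Definition sspt : sset :=
  @SSet (fun _ => unit) (fun _ _ _ x => x) (fun _ _ => erefl)
    (fun _ _ _ _ _ _ => erefl).

Program Definition simplex (n : nat) : sset :=
  @SSet (fun m => smap m n) (fun _ _ u t => scomp t u) _ _.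
Next Obligation. by apply: smap_eq. Qed.
Next Obligation. by apply: smap_eq. Qed.

Program Definition simplex_map m n (t : smap m n)
  : sset_map (simplex m) (simplex n) :=
  @SSetMap (simplex m) (simplex n) (fun _ u => scomp t u) _.
Next Obligation. by apply: smap_eq. Qed.

(** The horn: a simplex [t] of the n-simplex lies in it iff the image of [t]
    misses some vertex other than [k]. *)
Definition in_horn n (k : 'I_n.+1) m (t : smap m n) :=
  exists2 i : 'I_n.+1, i != k & forall a, t a != i.

Program Definition horn n (k : 'I_n.+1) : sset :=
  @SSet (fun m => {t : smap m n | in_horn k t})
    (fun _ _ u t => exist _ (scomp (proj1_sig t) u) _) _ _.
Next Obligation. by case: t => t [i ik ti]; exists i => // a; apply: ti. Qed.
Next Obligation. by case: x => t ht; apply: eq_exist; apply: smap_eq. Qed.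
Next Obligation. by case: x => p hp; apply: eq_exist; apply: smap_eq. Qed.

Definition horn_incl n (k : 'I_n.+1) : sset_map (horn k) (simplex n) :=
  @SSetMap (horn k) (simplex n) (fun _ t => proj1_sig t) (fun _ _ _ _ => erefl).

Definition kan (X : sset) :=
  forall n (k : 'I_n.+2) (h : sset_map (horn k) X),
    exists s : sset_map (simplex n.+1) X, sscomp s (horn_incl k) = h.

(** The vertex [i] of the 1-simplex, as a constant map defined on [X]. *)
Definition const_vertex (X : sset) (i : 'I_2) : sset_map X (simplex 1) :=
  @SSetMap X (simplex 1) (fun m _ => sconst m i) (fun _ _ _ _ => erefl).

Definition homotopy (X Y : sset) (f g : sset_map X Y) :=
  exists h : sset_map (ssprod X (simplex 1)) Y,
    sscomp h (sspair (ssid X) (const_vertex X ord0)) = f /\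
    sscomp h (sspair (ssid X) (const_vertex X ord_max)) = g.

(** The equivalence relation generated by homotopy: its classes are the path
    components of the function complex from X to Y. *)
Inductive homotopic (X Y : sset) : sset_map X Y -> sset_map X Y -> Prop :=
| homotopic_step f g : homotopy f g -> homotopic f g
| homotopic_refl f : homotopic f f
| homotopic_sym f g : homotopic f g -> homotopic g f
| homotopic_trans f g h : homotopic f g -> homotopic g h -> homotopic f h.

(** [f : X -> Y] is a weak equivalence if precomposition with [f] is a
    bijection [Y, K] -> [X, K] on homotopy classes for every Kan complex K;
    equivalently, the geometric realization of [f] is a weak homotopy
    equivalence. *)
Definition weq (X Y : sset) (f : sset_map X Y) :=
  forall K : sset, kan K ->
    (forall a b : sset_map Y K,
       homotopic (sscomp a f) (sscomp b f) -> homotopic a b) /\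
    (forall c : sset_map X K,
       exists a : sset_map Y K, homotopic (sscomp a f) c).

Definition mono (X Y : sset) (f : sset_map X Y) :=
  forall (Z : sset) (u v : sset_map Z X), sscomp f u = sscomp f v -> u = v.

Program Definition nerve (C : category) : sset :=
  @SSet (fun n => functor (ordcat n) C) (fun _ _ t s => fcomp s (ordmap t)) _ _.
Next Obligation. by rewrite ordmap_id; apply: functor_eq. Qed.
Next Obligation. by rewrite ordmap_comp; apply: functor_eq. Qed.

Program Definition nerve_map (C D : category) (F : functor C D)
  : sset_map (nerve C) (nerve D) :=
  @SSetMap (nerve C) (nerve D) (fun _ s => fcomp F s) _.
Next Obligation. by apply: functor_eq. Qed.

Lemma nerve_map_id C : nerve_map (fid C) = ssid (nerve C).
Proof. by apply: sset_map_eq => n s; apply: functor_eq. Qed.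

Lemma nerve_map_comp C D E (G : functor D E) (F : functor C D) :
  nerve_map (fcomp G F) = sscomp (nerve_map G) (nerve_map F).
Proof. by apply: sset_map_eq => n s; apply: functor_eq. Qed.

Record csspace := CSSpace {
  cs_ob :> nat -> sset;
  cs_map : forall m n, smap m n -> sset_map (cs_ob m) (cs_ob n);
  cs_map_id : forall n, cs_map (sid n) = ssid (cs_ob n);
  cs_map_comp : forall l m n (t : smap m n) (u : smap l m),
    cs_map (scomp t u) = sscomp (cs_map t) (cs_map u) }.

Arguments cs_map X {m n} t : rename.

Record csspace_map (X Y : csspace) := CSSpaceMap {
  csm_fun :> forall n, sset_map (X n) (Y n);
  csm_nat : forall m n (t : smap m n),
    sscomp (csm_fun n) (cs_map X t) = sscomp (cs_map Y t) (csm_fun m) }.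

Lemma csspace_map_eq (X Y : csspace) (f g : csspace_map X Y) :
  (forall n, f n = g n) -> f = g.
Proof.
case: f => f ef; case: g => g eg /= e.
have {}e : f = g by apply: functional_extensionality_dep.
by subst g; rewrite (Prop_irrelevance ef eg).
Qed.

Program Definition cscomp (X Y Z : csspace) (g : csspace_map Y Z)
    (f : csspace_map X Y) : csspace_map X Z :=
  @CSSpaceMap X Z (fun n => sscomp (g n) (f n)) _.
Next Obligation.
by rewrite -sscompA csm_nat sscompA csm_nat -sscompA.
Qed.

Program Definition cspt : csspace :=
  @CSSpace (fun _ => sspt) (fun _ _ _ => ssid sspt) _ _.
Next Obligation. by []. Qed.
Next Obligation. by apply: sset_map_eq. Qed.

Program Definition to_cspt (X : csspace) : csspace_map X cspt :=
  @CSSpaceMap X cspt (fun n => @SSetMap (X n) sspt (fun _ _ => tt) _) _.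
Next Obligation. by []. Qed.
Next Obligation. by apply: sset_map_eq. Qed.

Program Definition cssimplex : csspace :=
  @CSSpace simplex (fun _ _ t => simplex_map t) _ _.
Next Obligation. by apply: sset_map_eq => m u; apply: smap_eq. Qed.
Next Obligation. by apply: sset_map_eq => p v; apply: smap_eq. Qed.

(** Product of a cosimplicial space with a (constant) simplicial set. *)
Definition tensor_map (X X' K K' : sset) (f : sset_map X X') (g : sset_map K K')
  : sset_map (ssprod X K) (ssprod X' K') :=
  sspair (@SSetMap (ssprod X K) X' (fun n x => f n x.1)
            (fun _ _ t x => smap_nat f t x.1))
         (@SSetMap (ssprod X K) K' (fun n x => g n x.2)
            (fun _ _ t x => smap_nat g t x.2)).

Program Definition cstensor (X : csspace) (K : sset) : csspace :=
  @CSSpace (fun n => ssprod (X n) K)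
    (fun _ _ t => tensor_map (cs_map X t) (ssid K)) _ _.
Next Obligation. by apply: sset_map_eq => m [x k] /=; rewrite cs_map_id. Qed.
Next Obligation. by apply: sset_map_eq => p [x k] /=; rewrite cs_map_comp. Qed.

Program Definition cstensor_map (X X' : csspace) (K K' : sset)
    (f : csspace_map X X') (g : sset_map K K')
  : csspace_map (cstensor X K) (cstensor X' K') :=
  @CSSpaceMap (cstensor X K) (cstensor X' K') (fun n => tensor_map (f n) g) _.
Next Obligation.
apply: sset_map_eq => p [x k] /=; congr pair.
exact: (congr1 (fun h : sset_map _ _ => h p x) (csm_nat f t)).
Qed.

Program Definition csid (X : csspace) : csspace_map X X :=
  @CSSpaceMap X X (fun n => ssid (X n)) _.
Next Obligation. exact: sset_map_eq. Qed.

Program Definition cshom (X Y : csspace) : sset :=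
  @SSet (fun n => csspace_map (cstensor X (simplex n)) Y)
    (fun _ _ t f => cscomp f (cstensor_map (csid X) (simplex_map t))) _ _.
Next Obligation.
apply: csspace_map_eq => m; apply: sset_map_eq => p [y u] /=.
by congr (_ _ (_, _)); apply: smap_eq.
Qed.
Next Obligation. by apply: csspace_map_eq => p; apply: sset_map_eq. Qed.

Program Definition cshom_post (X Y Z : csspace) (g : csspace_map Y Z)
  : sset_map (cshom X Y) (cshom X Z) :=
  @SSetMap (cshom X Y) (cshom X Z) (fun _ f => cscomp g f) _.
Next Obligation. by apply: csspace_map_eq => p; apply: sset_map_eq. Qed.

Program Definition cshom_pre (X Y Z : csspace) (f : csspace_map X Y)
  : sset_map (cshom Y Z) (cshom X Z) :=
  @SSetMap (cshom Y Z) (cshom X Z)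
    (fun n g => cscomp g (cstensor_map f (ssid (simplex n)))) _.
Next Obligation. by apply: csspace_map_eq => p; apply: sset_map_eq. Qed.

Definition cs_weq (X Y : csspace) (f : csspace_map X Y) := forall n, weq (f n).

Definition cs_cof (X Y : csspace) (f : csspace_map X Y) := forall n, mono (f n).

Definition inj_fibration (X Y : csspace) (p : csspace_map X Y) :=
  forall (A B : csspace) (i : csspace_map A B), cs_cof i -> cs_weq i ->
  forall (a : csspace_map A X) (b : csspace_map B Y), cscomp p a = cscomp b i ->
  exists l : csspace_map B X, cscomp l i = a /\ cscomp p l = b.

Definition inj_fibrant (X : csspace) := inj_fibration (to_cspt X).

Record ccategory := CCategory {
  cc_ob :> nat -> category;
  cc_map : forall m n, smap m n -> functor (cc_ob m) (cc_ob n);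
  cc_map_id : forall n, cc_map (sid n) = fid (cc_ob n);
  cc_map_comp : forall l m n (t : smap m n) (u : smap l m),
    cc_map (scomp t u) = fcomp (cc_map t) (cc_map u) }.

Arguments cc_map C {m n} t : rename.

Record cgroupoid := CGroupoid {
  cg_cat :> ccategory;
  cg_inv : forall n, inverses (cg_cat n) }.

Record ccat_map (C D : ccategory) := CCatMap {
  ccm_fun :> forall n, functor (C n) (D n);
  ccm_nat : forall m n (t : smap m n),
    fcomp (ccm_fun n) (cc_map C t) = fcomp (cc_map D t) (ccm_fun m) }.

Program Definition cnerve (C : ccategory) : csspace :=
  @CSSpace (fun n => nerve (C n)) (fun _ _ t => nerve_map (cc_map C t)) _ _.
Next Obligation. by rewrite cc_map_id nerve_map_id. Qed.
Next Obligation. by rewrite cc_map_comp nerve_map_comp. Qed.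

Program Definition cnerve_map (C D : ccategory) (F : ccat_map C D)
  : csspace_map (cnerve C) (cnerve D) :=
  @CSSpaceMap (cnerve C) (cnerve D) (fun n => nerve_map (F n)) _.
Next Obligation. by rewrite -!nerve_map_comp ccm_nat. Qed.

Definition cg_weq (G H : cgroupoid) (j : ccat_map G H) := cs_weq (cnerve_map j).

Definition stack (H : cgroupoid) := inj_fibrant (cnerve H).

Definition stack_completion (G H : cgroupoid) (j : ccat_map G H) :=
  cg_weq j /\ stack H.

Definition cordcat : ccategory :=
  @CCategory ordcat (fun _ _ t => ordmap t) ordmap_id ordmap_comp.

Record ccat_trans (C D : ccategory) (E F : ccat_map C D) := CCatTrans {
  cct_fun :> forall n, nattrans (E n) (F n);
  cct_nat : forall m n (t : smap m n) (x : C m),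
    Arrow (fmap (cc_map D t) (cct_fun m x)) = Arrow (cct_fun n (cc_map C t x)) }.

Lemma ccat_trans_eq (C D : ccategory) (E F : ccat_map C D)
    (a b : ccat_trans E F) : (forall n x, a n x = b n x) -> a = b.
Proof.
case: a => a ea; case: b => b eb /= e; have {}e : a = b.
  by apply: functional_extensionality_dep => n; apply: nattrans_eq.
by subst b; rewrite (Prop_irrelevance ea eb).
Qed.

Lemma ccm_ob (C D : ccategory) (F : ccat_map C D) m n (t : smap m n) (x : C m) :
  F n (cc_map C t x) = cc_map D t (F m x).
Proof. exact: (congr1 (fun P : functor _ _ => P x) (ccm_nat F t)). Qed.

Lemma arrow_idm (C : category) (x y : C) : x = y -> Arrow (idm x) = Arrow (idm y).
Proof. by move=> ->. Qed.

Lemma fmap_inv (C D : category) (i : inverses C) (k : inverses D)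
    (F : functor C D) (x y : C) (f : hom x y) :
  fmap F (inv i f) = inv k (fmap F f).
Proof.
rewrite -[LHS]comp_idl -(comp_invl k (fmap F f)) -comp_assoc -fmap_comp.
by rewrite comp_invr fmap_id comp_idr.
Qed.

Program Definition cct_id (C D : ccategory) (F : ccat_map C D) : ccat_trans F F :=
  @CCatTrans C D F F (fun n => nid (F n)) _.
Next Obligation. by rewrite fmap_id; apply/arrow_idm/esym/ccm_ob. Qed.

Program Definition cct_comp (C D : ccategory) (E F H : ccat_map C D)
    (b : ccat_trans F H) (a : ccat_trans E F) : ccat_trans E H :=
  @CCatTrans C D E H (fun n => nvcomp (b n) (a n)) _.
Next Obligation. by rewrite fmap_comp; apply: arrow_comp; apply: cct_nat. Qed.

Program Definition cct_inv (C D : ccategory)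
    (i : forall n, inverses (D n)) (E F : ccat_map C D) (a : ccat_trans E F) : ccat_trans F E :=
  @CCatTrans C D F E (fun n => ninv (i n) (a n)) _.
Next Obligation.
by rewrite (fmap_inv _ (i n)); apply: arrow_inv; apply: cct_nat.
Qed.

Program Definition map_category (C D : ccategory) : category :=
  @Category (ccat_map C D) (@ccat_trans C D) (@cct_id C D) (@cct_comp C D) _ _ _.
Next Obligation. by apply: ccat_trans_eq => n z /=; rewrite comp_idl. Qed.
Next Obligation. by apply: ccat_trans_eq => n z /=; rewrite comp_idr. Qed.
Next Obligation. by apply: ccat_trans_eq => n w /=; rewrite comp_assoc. Qed.

Program Definition map_groupoid (C : ccategory) (G : cgroupoid) : groupoid :=
  @Groupoid (map_category C G)
    (@Inverses (map_category C G) (cct_inv (cg_inv G)) _ _).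
Next Obligation. by apply: ccat_trans_eq => n z /=; rewrite comp_invl. Qed.
Next Obligation. by apply: ccat_trans_eq => n z /=; rewrite comp_invr. Qed.

(** The groupoid G^Delta of maps from the cosimplicial category n |-> n to G. *)
Definition delta_groupoid (G : cgroupoid) : groupoid := map_groupoid cordcat G.

(** The groupoid of global sections: the limit of the functor n |-> H^n. *)

Record section_ob (H : ccategory) := SectionOb {
  so_fun :> forall n, H n;
  so_nat : forall m n (t : smap m n), cc_map H t (so_fun m) = so_fun n }.

Record section_hom (H : ccategory) (x y : section_ob H) := SectionHom {
  sh_fun :> forall n, hom (x n) (y n);
  sh_nat : forall m n (t : smap m n),
    Arrow (fmap (cc_map H t) (sh_fun m)) = Arrow (sh_fun n) }.

Lemma section_hom_eq (H : ccategory) (x y : section_ob H)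
    (f g : section_hom x y) : (forall n, f n = g n) -> f = g.
Proof.
case: f => f ef; case: g => g eg /= e.
have {}e : f = g by apply: functional_extensionality_dep.
by subst g; rewrite (Prop_irrelevance ef eg).
Qed.

Program Definition sh_id (H : ccategory) (x : section_ob H) : section_hom x x :=
  @SectionHom H x x (fun n => idm (x n)) _.
Next Obligation. by rewrite fmap_id; apply/arrow_idm/so_nat. Qed.

Program Definition sh_comp (H : ccategory) (x y z : section_ob H)
    (g : section_hom y z) (f : section_hom x y) : section_hom x z :=
  @SectionHom H x z (fun n => comp (g n) (f n)) _.
Next Obligation. by rewrite fmap_comp; apply: arrow_comp; apply: sh_nat. Qed.

Program Definition sh_inv (H : ccategory)
    (i : forall n, inverses (H n)) (x y : section_ob H) (f : section_hom x y) : section_hom y x :=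
  @SectionHom H y x (fun n => inv (i n) (f n)) _.
Next Obligation.
by rewrite (fmap_inv _ (i n)); apply: arrow_inv; apply: sh_nat.
Qed.

Program Definition section_category (H : ccategory) : category :=
  @Category (section_ob H) (@section_hom H) (@sh_id H) (@sh_comp H) _ _ _.
Next Obligation. by apply: section_hom_eq => n /=; rewrite comp_idl. Qed.
Next Obligation. by apply: section_hom_eq => n /=; rewrite comp_idr. Qed.
Next Obligation. by apply: section_hom_eq => n /=; rewrite comp_assoc. Qed.

Program Definition global_sections (H : cgroupoid) : groupoid :=
  @Groupoid (section_category H)
    (@Inverses (section_category H) (sh_inv (cg_inv H)) _ _).
Next Obligation. by apply: section_hom_eq => n /=; rewrite comp_invl. Qed.
Next Obligation. by apply: section_hom_eq => n /=; rewrite comp_invr. Qed.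

(* Main.v *)
From mathcomp Require Import all_boot boolp.
Require Import Defs.

(** The nerve is fully faithful and the nerve of a groupoid is a Kan complex, so
    a functor of groupoids is an equivalence exactly when its nerve is a weak
    equivalence, and the three function complexes are the nerves of the
    groupoids G^Delta, H^Delta and of the groupoid of global sections of H.

    A map from the cosimplicial category n |-> n to G is a descent datum: it is
    determined by an object x of G^0 and the values of the structure maps on x,
    together with morphisms between those values in the G^n. Such data can be
    transported along j because every G^n -> H^n is an equivalence.

    A global section of H gives a constant descent datum, and this functor is
    always fully faithful. When BH is injective fibrant, a descent datum
    Delta -> BH extends along the trivial cofibration of Delta into its cone
    n |-> Delta^(n+1). The value of the extension at the cone points is a global
    section, and the edges to the cone points identify it with the datum. *)

Set Implicit Arguments.
Unset Strict Implicit.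
Unset Printing Implicit Defensive.

#[local] Obligation Tactic := intros; simpl.

(** * Weak equivalences *)

Lemma sscomp_idr (X Y : sset) (f : sset_map X Y) : sscomp f (ssid X) = f.
Proof. exact: sset_map_eq. Qed.

Lemma homotopic_post (X Y Z : sset) (k : sset_map Y Z) (f g : sset_map X Y) :
  homotopic f g -> homotopic (sscomp k f) (sscomp k g).
Proof.
elim=> [{}f {}g [h [<- <-]]|{}f|{}f {}g _ /homotopic_sym //|{}f {}g h _ fg _].
- by apply: homotopic_step; exists (sscomp k h); rewrite !sscompA.
- exact: homotopic_refl.
- exact: homotopic_trans.
Qed.

Lemma homotopic_pre (X Y Z : sset) (k : sset_map X Y) (f g : sset_map Y Z) :
  homotopic f g -> homotopic (sscomp f k) (sscomp g k).
Proof.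
elim=> [{}f {}g [h [<- <-]]|{}f|{}f {}g _ /homotopic_sym //|{}f {}g h _ fg _].
- apply: homotopic_step; exists (sscomp h (tensor_map k (ssid (simplex 1)))).
  by split; apply: sset_map_eq.
- exact: homotopic_refl.
- exact: homotopic_trans.
Qed.

(** Precomposition with [g] is inverse, on homotopy classes, to precomposition with [f]. *)
Lemma hoequiv_weq (X Y : sset) (f : sset_map X Y) (g : sset_map Y X) :
  homotopic (sscomp g f) (ssid X) -> homotopic (sscomp f g) (ssid Y) -> weq f.
Proof.
move=> gf fg K _; split=> [a b /(homotopic_pre g)|c].
  rewrite -!sscompA => h.
  have := homotopic_post a fg; rewrite sscomp_idr => /homotopic_sym ea.
  have := homotopic_post b fg; rewrite sscomp_idr => eb.
  exact: homotopic_trans ea (homotopic_trans h eb).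
exists (sscomp c g); rewrite -sscompA -[X in homotopic _ X]sscomp_idr.
exact: homotopic_post.
Qed.

(** The inverses need only be given degree by degree: their naturality follows from that of [f]. *)
Lemma bij_weq (X Y : sset) (f : sset_map X Y) (g : forall n, Y n -> X n) :
  (forall n, cancel (f n) (g n)) -> (forall n, cancel (g n) (f n)) -> weq f.
Proof.
move=> fK gK.
have gnat m n (t : smap m n) (y : Y n) : g m (sact t y) = sact t (g n y).
  by rewrite -[y in LHS]gK -smap_nat fK.
apply: (@hoequiv_weq _ _ f (@SSetMap Y X g gnat)).
  rewrite (_ : sscomp _ _ = ssid X); first exact: homotopic_refl.
  by apply: sset_map_eq => n x; apply: fK.
rewrite (_ : sscomp _ _ = ssid Y); first exact: homotopic_refl.
by apply: sset_map_eq => n x; apply: gK.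
Qed.

Lemma weq_comp (X Y Z : sset) (g : sset_map Y Z) (f : sset_map X Y) :
  weq g -> weq f -> weq (sscomp g f).
Proof.
move=> wg wf K kK; have [gi gs] := wg K kK; have [fi fs] := wf K kK.
split=> [a b|c]; first by rewrite !sscompA => /fi /gi.
have [b bc] := fs c; have [a ab] := gs b; exists a; rewrite sscompA.
exact: homotopic_trans (homotopic_pre f ab) bc.
Qed.

(** One case of two-out-of-three: precomposition with [f] and with the composite is bijective on
    homotopy classes, so precomposition with [g] is too. *)
Lemma weq_cancel_right (X Y Z : sset) (g : sset_map Y Z) (f : sset_map X Y) :
  weq f -> weq (sscomp g f) -> weq g.
Proof.
move=> wf wgf K kK; have [gfi gfs] := wgf K kK; have [fi fs] := wf K kK.
split=> [a b /(homotopic_pre f)|c].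
  by rewrite -!sscompA => /gfi.
have [a ac] := gfs (sscomp c f); exists a; apply: fi.
by rewrite -sscompA.
Qed.

(** The homotopy that slides [f] to the last vertex: positions over vertex 0 of the interval keep
    their value, those over vertex 1 go to [ord_max]. Order is preserved because [ord_max] is the
    greatest element. *)
Program Definition slide_map (X : sset) n (f : sset_map X (simplex n)) :
    sset_map (ssprod X (simplex 1)) (simplex n) :=
  @SSetMap (ssprod X (simplex 1)) (simplex n)
    (fun m x => @Smap m n
       (fun i => if x.2 i == ord0 then f m x.1 i else ord_max) _) _.
Next Obligation.
move=> i j le_ij; case: eqP => [_|]; last first.
  move/eqP=> xi; case: eqP => // xj.
  have := sfun_homo x.2 le_ij; rewrite xj leqn0 => /eqP e0.
  by case/eqP: xi; apply: val_inj.
case: eqP => _; [exact: sfun_homo|exact: leq_ord].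
Qed.
Next Obligation. by apply: smap_eq => i /=; rewrite smap_nat. Qed.

(** Both maps slide to the constant map at the last vertex. The resulting zigzag is enough,
    [homotopic] being the generated equivalence relation. It follows that every map between
    simplices is a homotopy equivalence. *)
Lemma simplex_maps_homotopic (X : sset) n (f g : sset_map X (simplex n)) :
  homotopic f g.
Proof.
pose top := @SSetMap X (simplex n) (fun m _ => sconst m ord_max)
  (fun _ _ _ _ => erefl).
suff to_top (k : sset_map X (simplex n)) : homotopic k top.
  exact: homotopic_trans (to_top f) (homotopic_sym (to_top g)).
apply: homotopic_step; exists (slide_map k).
by split; apply: sset_map_eq => m x; apply: smap_eq.
Qed.

Lemma simplex_map_weq m n (t : smap m n) : weq (simplex_map t).
Proof.
by apply: (@hoequiv_weq _ _ _ (simplex_map (sconst n ord0)));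
  apply: simplex_maps_homotopic.
Qed.

(** * Arrows, equivalences of groupoids *)

Lemma arrow_src (C : category) (x y x' y' : C) (f : hom x y) (f' : hom x' y') :
  Arrow f = Arrow f' -> x = x'.
Proof. by move/(congr1 (@src C)). Qed.

Lemma arrow_tgt (C : category) (x y x' y' : C) (f : hom x y) (f' : hom x' y') :
  Arrow f = Arrow f' -> y = y'.
Proof. by move/(congr1 (@tgt C)). Qed.

(** Transport of a morphism along equalities of its endpoints that are not definitional. Passing to
    [Arrow] erases it, which is how equations between transported morphisms are proved below. *)
Definition retype (C : category) (x y x' y' : C) (ex : x = x') (ey : y = y')
    (f : hom x y) : hom x' y' :=
  ecast b (hom x' b) ey (ecast a (hom a y) ex f).

Lemma arrow_retype (C : category) (x y x' y' : C) (ex : x = x') (ey : y = y')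
    (f : hom x y) : Arrow (retype ex ey f) = Arrow f.
Proof. by case: _ / ex; case: _ / ey. Qed.

Lemma arrow_fmap (C D : category) (F : functor C D) (x y x' y' : C)
    (f : hom x y) (f' : hom x' y') :
  Arrow f = Arrow f' -> Arrow (fmap F f) = Arrow (fmap F f').
Proof. by case/arrowE=> ex [ey ->]; case: _ / ex; case: _ / ey. Qed.

Lemma functor_arrow (C D : category) (F G : functor C D) (x y : C) (f : hom x y) :
  F = G -> Arrow (fmap F f) = Arrow (fmap G f).
Proof. by move=> ->. Qed.

Lemma functor_ob (C D : category) (F G : functor C D) (x : C) :
  F = G -> F x = G x.
Proof. by move=> ->. Qed.

Lemma fcompA (A B C D : category) (H : functor C D) (G : functor B C)
    (F : functor A B) : fcomp H (fcomp G F) = fcomp (fcomp H G) F.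
Proof. exact: functor_eq. Qed.

Lemma inv_unique (C : category) (i : inverses C) (x y : C) (f : hom x y)
    (g : hom y x) : comp g f = idm x -> inv i f = g.
Proof.
by move=> gf; rewrite -[LHS]comp_idl -gf -comp_assoc comp_invr comp_idr.
Qed.

Lemma inv_idm (C : category) (i : inverses C) (x : C) : inv i (idm x) = idm x.
Proof. by apply: inv_unique; rewrite comp_idl. Qed.

Lemma comp_eq_invr (C : category) (i : inverses C) (x y z : C) (g : hom y z)
    (f : hom x y) (h : hom x z) : comp g f = h -> g = comp h (inv i f).
Proof. by move=> <-; rewrite -comp_assoc comp_invr comp_idr. Qed.

Lemma comp_eq_invl (C : category) (i : inverses C) (x y z : C) (g : hom y z)
    (f : hom x y) (h : hom x z) : comp g f = h -> f = comp (inv i g) h.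
Proof. by move=> <-; rewrite comp_assoc comp_invl comp_idl. Qed.

Lemma gpd_is_iso (C : category) (i : inverses C) (x y : C) (f : hom x y) :
  is_iso f.
Proof. by exists (inv i f); rewrite comp_invl comp_invr. Qed.

Section NatIso.
Variables (C D : category) (iD : inverses D).

Lemma nat_iso (F G : functor C D) : nattrans F G -> nat_isomorphic F G.
Proof. by move=> a; exists a => x; apply: gpd_is_iso. Qed.

Lemma nat_iso_sym (F G : functor C D) :
  nat_isomorphic F G -> nat_isomorphic G F.
Proof. by case=> a _; exact: (nat_iso (ninv iD a)). Qed.

Lemma nat_iso_trans (F G H : functor C D) :
  nat_isomorphic F G -> nat_isomorphic G H -> nat_isomorphic F H.
Proof. by case=> a _ [b _]; exact: (nat_iso (nvcomp b a)). Qed.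

End NatIso.

Program Definition whisker (A B C D : category) (K : functor C D)
    (F G : functor B C) (L : functor A B) (a : nattrans F G) :
    nattrans (fcomp K (fcomp F L)) (fcomp K (fcomp G L)) :=
  @Nattrans A D (fcomp K (fcomp F L)) (fcomp K (fcomp G L))
    (fun x => fmap K (a (L x))) _.
Next Obligation. by rewrite -!fmap_comp ncompP. Qed.

(** * Equivalences as fully faithful, essentially surjective functors *)

Definition equivalence (C D : category) (F : functor C D) :=
  exists G : functor D C,
    nat_isomorphic (fid C) (fcomp G F) /\ nat_isomorphic (fcomp F G) (fid D).

Definition faithful (C D : category) (F : functor C D) :=
  forall (x y : C) (f g : hom x y), fmap F f = fmap F g -> f = g.

Definition full (C D : category) (F : functor C D) :=
  forall (x y : C) (g : hom (F x) (F y)), exists f : hom x y, fmap F f = g.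

Definition essurj (C D : category) (F : functor C D) :=
  forall y : D, exists x : C, exists f : hom (F x) y, True.

Lemma faithful_arrow (C D : category) (F : functor C D) (x y x' y' : C)
    (f : hom x y) (f' : hom x' y') :
  faithful F -> x = x' -> y = y' ->
  Arrow (fmap F f) = Arrow (fmap F f') -> Arrow f = Arrow f'.
Proof.
by move=> Ff ex ey; subst x' y' => /arrow_inj /Ff ->.
Qed.

Definition full_lift (C D : category) (F : functor C D) (Ff : full F) (x y : C)
    (g : hom (F x) (F y)) : hom x y := proj1_sig (cid (Ff x y g)).

Lemma full_liftK (C D : category) (F : functor C D) (Ff : full F) (x y : C)
    (g : hom (F x) (F y)) : fmap F (full_lift Ff g) = g.
Proof. by rewrite /full_lift; case: cid. Qed.

(** A functor isomorphic to [E] that factors through [F], with prescribed values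
    [v] on objects. *)
Program Definition lift_functor (A C D : category) (iD : inverses D)
    (F : functor C D) (Ff : full F) (Fi : faithful F) (E : functor A D)
    (v : A -> C) (b : forall c, hom (F (v c)) (E c)) : functor A C :=
  @Functor A C v
    (fun x y f => full_lift Ff (comp (inv iD (b y)) (comp (fmap E f) (b x)))) _ _.
Next Obligation.
by apply: Fi; rewrite full_liftK !fmap_id comp_idl comp_invl.
Qed.
Next Obligation.
apply: Fi; rewrite !fmap_comp !full_liftK -!comp_assoc.
by rewrite (comp_assoc (b y)) comp_invr comp_idl.
Qed.

Program Definition lift_functor_trans (A C D : category) (iD : inverses D)
    (F : functor C D) (Ff : full F) (Fi : faithful F) (E : functor A D)
    (v : A -> C) (b : forall c, hom (F (v c)) (E c)) :
    nattrans (fcomp F (lift_functor iD Ff Fi b)) E :=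
  @Nattrans A D (fcomp F (lift_functor iD Ff Fi b)) E b _.
Next Obligation. by rewrite full_liftK comp_assoc comp_invr comp_idl. Qed.

Lemma ff_equivalence (C D : category) (iC : inverses C) (iD : inverses D)
    (F : functor C D) : full F -> faithful F -> essurj F -> equivalence F.
Proof.
move=> Ff Fi Fe; pose v y := proj1_sig (cid (Fe y)).
have b y : hom (F (v y)) y by rewrite /v; case: cid => x /= /cid [].
exists (lift_functor iD Ff Fi (E := fid D) b); split; last first.
  exact/(nat_iso iD)/lift_functor_trans.
(* The unit is the preimage under [F] of the inverse of the chosen isomorphism at [F x]; its
   naturality can be checked after applying [F]. *)
pose a x : hom x (v (F x)) := full_lift Ff (inv iD (b (F x))).
apply: (nat_iso iC); exists a => x y f /=.
apply: Fi; rewrite !fmap_comp !full_liftK -!comp_assoc.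
by rewrite comp_invr comp_idr.
Qed.

(** Naturality of the unit recovers [f] from [F f], so [F] is faithful; the counit gives the same
    for the inverse [G]. For fullness, conjugating [G g] by the unit yields an [f] with
    [G (F f) = G g], and [G] is faithful. *)
Lemma equivalence_ff (C D : category) (iC : inverses C) (iD : inverses D)
    (F : functor C D) :
  equivalence F -> [/\ full F, faithful F & essurj F].
Proof.
case=> G [[a _] [b _]].
have nat_a x y (f : hom x y) : f = comp (inv iC (a y)) (comp (fmap G (fmap F f)) (a x)).
  by apply: comp_eq_invl; apply: (ncompP a).
have Fi : faithful F.
  by move=> x y f g e; rewrite (nat_a _ _ f) e -nat_a.
have Gi : faithful G.
  move=> x y f g e.
  have nat_b (h : hom x y) : h = comp (comp (b y) (fmap F (fmap G h))) (inv iD (b x)).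
    by apply: comp_eq_invr; rewrite -(ncompP b).
  by rewrite (nat_b f) e -nat_b.
split=> // [x y g|y].
  exists (comp (inv iC (a y)) (comp (fmap G g) (a x))); apply: Gi.
  set f := comp _ _.
  have e : comp (fmap G (fmap F f)) (a x) = comp (fmap G g) (a x).
    by rewrite -[LHS](ncompP a) /f comp_assoc comp_invr comp_idl.
  by rewrite (comp_eq_invr iC e) -comp_assoc comp_invr comp_idr.
by exists (G y), (b y).
Qed.

Lemma equivalence_comp (C D E : category) (iC : inverses C) (iE : inverses E)
    (G : functor D E) (F : functor C D) :
  equivalence F -> equivalence G -> equivalence (fcomp G F).
Proof.
case=> F' [[a _] [b _]] [G' [[c _] [d _]]]; exists (fcomp F' G'); split.
  apply: (nat_iso_trans iC (nat_iso iC a)).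
  apply: (nat_iso iC).
  have := whisker F' F c; rewrite !fcompA.
  by rewrite (_ : fcomp (fcomp F' (fid D)) F = fcomp F' F) //; apply: functor_eq.
apply: (nat_iso_trans iE _ (nat_iso iE d)).
apply: (nat_iso iE).
have := whisker G G' b; rewrite !fcompA.
by rewrite (_ : fcomp (fcomp G (fid D)) G' = fcomp G G') //; apply: functor_eq.
Qed.

Lemma equivalence_inv (C D : category) (iC : inverses C) (iD : inverses D)
    (F : functor C D) : equivalence F ->
  exists2 G : functor D C, equivalence G &
    nat_isomorphic (fid C) (fcomp G F) /\ nat_isomorphic (fcomp F G) (fid D).
Proof.
case=> G [a b]; exists G => //; exists F.
by split; [exact: (nat_iso_sym iD b)|exact: (nat_iso_sym iC a)].
Qed.

(** * The nerve is fully faithful *)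

Section Chain.
Variables (C : category) (x y z : C) (f : hom x y) (g : hom y z).

(** Indexing by all of [nat], constant from 2 on, lets one formula produce vertices, edges and
    composition triangles, for [n] equal to 0, 1 and 2. *)
Definition chain_ob (i : nat) : C :=
  match i with 0 => x | 1 => y | _ => z end.

Definition chain_hom (i j : nat) : (i <= j)%N -> hom (chain_ob i) (chain_ob j) :=
  match i, j return (i <= j)%N -> hom (chain_ob i) (chain_ob j) with
  | 0, 0 => fun _ => idm x
  | 0, 1 => fun _ => f
  | 0, _.+2 => fun _ => comp g f
  | 1, 1 => fun _ => idm y
  | 1, _.+2 => fun _ => g
  | _.+2, _.+2 => fun _ => idm z
  | 1, 0 => fun le => False_rect _ (notF le)
  | _.+2, 0 => fun le => False_rect _ (notF le)
  | _.+2, 1 => fun le => False_rect _ (notF le)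
  end.

(** The n-simplex of the nerve with vertices x, y, z, z, ... *)
Program Definition chain n : functor (ordcat n) C :=
  @Functor (ordcat n) C chain_ob (fun i j le => chain_hom le) _ _.
Next Obligation. by case: x0 => [[|[|i]]]. Qed.
Next Obligation.
case: x0 y0 z0 g0 f0 => [[|[|i]] ?] [[|[|j]] ?] [[|[|k]] ?] //= *;
  by rewrite ?comp_idl ?comp_idr.
Qed.

End Chain.

Definition chain1 (C : category) (x y : C) (f : hom x y) :
  functor (ordcat 1) C := chain f (idm y) 1.

Definition le01 : @hom (ordcat 1) ord0 ord_max := isT.

Definition edge (C : category) (s : functor (ordcat 1) C) : arrow C :=
  Arrow (fmap s le01).

(** The ordinal 1 has a single non-identity morphism, and the arrow [edge s] also records the two
    endpoints. *)
Lemma edge_inj (C : category) (s t : functor (ordcat 1) C) :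
  edge s = edge t -> s = t.
Proof.
move=> e; have e0 := arrow_src e; have e1 := arrow_tgt e.
have I2 (i : 'I_2) : i = ord0 \/ i = ord_max.
  by case: i => [[|[|//]] ?]; [left|right]; apply: val_inj.
apply: functor_eq => [i|i j le_ij]; first by case: (I2 i) => ->.
case: (I2 i) => ei; case: (I2 j) => ej; subst i j.
- by rewrite (bool_irrelevance le_ij (leqnn _)) !(fmap_id _ (ord0 : ordcat 1)) e0.
- by rewrite (bool_irrelevance le_ij le01).
- by [].
- by rewrite (bool_irrelevance le_ij (leqnn _)) !(fmap_id _ (ord_max : ordcat 1)) e1.
Qed.

Lemma edge_chain1 (C : category) (x y : C) (f : hom x y) :
  edge (chain1 f) = Arrow f.
Proof. by []. Qed.

Program Definition sedge n (i j : 'I_n.+1) (le_ij : (i <= j)%N) : smap 1 n :=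
  @Smap 1 n (fun a => if a == ord0 then i else j) _.
Next Obligation.
by move=> [[|[|//]] ?] [[|[|//]] ?].
Qed.

Lemma edge_sedge (C : category) n (s : functor (ordcat n) C) (i j : ordcat n)
    (le_ij : hom i j) : edge (fcomp s (ordmap (sedge le_ij))) = Arrow (fmap s le_ij).
Proof. by rewrite /edge /=; congr (Arrow (fmap s _)); apply: bool_irrelevance. Qed.

(** Naturality expresses every morphism in a simplex of the image through the values of [a] on
    1-simplices; this is why a map into a nerve is controlled by its edges. *)
Lemma nerve_map_edge (X : sset) (D : category) (a : sset_map X (nerve D)) n
    (x : X n) (i j : ordcat n) (le_ij : hom i j) :
  Arrow (fmap (a n x) le_ij) = edge (a 1 (sact (sedge le_ij) x)).
Proof. by rewrite smap_nat edge_sedge. Qed.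

Lemma nerve_map_vertex (X : sset) (D : category) (a : sset_map X (nerve D)) n
    (x : X n) (i : ordcat n) : a n x i = a 0 (sact (sconst 0 i) x) ord0.
Proof. by rewrite smap_nat. Qed.

Section NerveFull.
Variables (C D : category) (a : sset_map (nerve C) (nerve D)).

Let vertex (x : C) : functor (ordcat 0) C := chain (idm x) (idm x) 0.

Definition nerve_ob (x : C) : D := a 0 (vertex x) ord0.

Lemma vertex_eq (s : functor (ordcat 0) C) : s = vertex (s ord0).
Proof.
apply: functor_eq => [i|i j le_ij] /=; first by rewrite (ord1 i).
rewrite (ord1 i) (ord1 j) in le_ij *.
by rewrite (bool_irrelevance le_ij (leqnn _)) (fmap_id _ (ord0 : ordcat 0)).
Qed.

Lemma nerve_obE n (s : functor (ordcat n) C) i : a n s i = nerve_ob (s i).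
Proof.
rewrite nerve_map_vertex /nerve_ob; congr (a 0 _ _).
exact: (vertex_eq (sact (s := nerve C) _ _)).
Qed.

Definition nerve_hom (x y : C) (f : hom x y) : hom (nerve_ob x) (nerve_ob y) :=
  retype (nerve_obE (chain1 f) ord0) (nerve_obE (chain1 f) ord_max)
    (fmap (a 1 (chain1 f)) le01).

Lemma nerve_homE n (s : functor (ordcat n) C) i j (le_ij : hom i j) :
  Arrow (fmap (a n s) le_ij) = Arrow (nerve_hom (fmap s le_ij)).
Proof.
rewrite arrow_retype nerve_map_edge; congr (edge (a 1 _)).
by apply: edge_inj; rewrite edge_sedge edge_chain1.
Qed.

Program Definition nerve_functor : functor C D :=
  @Functor C D nerve_ob nerve_hom _ _.
Next Obligation.
apply: arrow_inj; have := nerve_homE (vertex x) (idm (ord0 : ordcat 0)).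
by rewrite !fmap_id => <-; apply: arrow_idm; apply: nerve_obE.
Qed.
Next Obligation.
(* The triangle with edges [f], [g] and their composite is sent by [a] to a functor on the ordinal
   2, and that functor preserves the composition 0 to 1 to 2. *)
apply: arrow_inj; pose s := chain f g 2.
pose i0 : ordcat 2 := ord0; pose i1 : ordcat 2 := @Ordinal 3 1 isT.
pose i2 : ordcat 2 := ord_max.
have le12 : @hom (ordcat 2) i1 i2 by [].
have le01 : @hom (ordcat 2) i0 i1 by [].
have := nerve_homE s (comp le12 le01); rewrite fmap_comp /= => <-.
by apply: arrow_comp; rewrite nerve_homE.
Qed.

Lemma nerve_functorK : nerve_map nerve_functor = a.
Proof.
apply: sset_map_eq => n s; apply: functor_eq => [i|i j le_ij] /=.
  by rewrite nerve_obE.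
by rewrite nerve_homE.
Qed.

End NerveFull.

Lemma nerve_map_inj (C D : category) (F G : functor C D) :
  nerve_map F = nerve_map G -> F = G.
Proof.
move=> e; have ev n (s : functor (ordcat n) C) : fcomp F s = fcomp G s.
  exact: (congr1 (fun h : sset_map (nerve C) (nerve D) => h n s) e).
apply: functor_eq => [x|x y f].
  exact: (@functor_ob _ _ _ _ (ord0 : ordcat 1) (ev 1 (chain1 (idm x)))).
exact: (@functor_arrow _ _ _ _ _ _ le01 (ev 1 (chain1 f))).
Qed.

(** * Products of categories and their nerves *)

Program Definition prodcat (C D : category) : category :=
  @Category (C * D)%type (fun x y => (hom x.1 y.1 * hom x.2 y.2)%type)
    (fun x => (idm x.1, idm x.2))
    (fun _ _ _ g f => (comp g.1 f.1, comp g.2 f.2)) _ _ _.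
Next Obligation. by case: f => a b; rewrite /= !comp_idl. Qed.
Next Obligation. by case: f => a b; rewrite /= !comp_idr. Qed.
Next Obligation. by rewrite /= !comp_assoc. Qed.

Definition prodfst (C D : category) : functor (prodcat C D) C :=
  @Functor (prodcat C D) C fst (fun _ _ f => f.1) (fun _ => erefl)
    (fun _ _ _ _ _ => erefl).

Definition prodsnd (C D : category) : functor (prodcat C D) D :=
  @Functor (prodcat C D) D snd (fun _ _ f => f.2) (fun _ => erefl)
    (fun _ _ _ _ _ => erefl).

Program Definition pairing (A C D : category) (F : functor A C) (G : functor A D) :
    functor A (prodcat C D) :=
  @Functor A (prodcat C D) (fun x => (F x, G x)) (fun _ _ f => (fmap F f, fmap G f))
    _ _.
Next Obligation. by rewrite !fmap_id. Qed.
Next Obligation. by rewrite !fmap_comp. Qed.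

Definition smap_of m n (F : functor (ordcat m) (ordcat n)) : smap m n :=
  @Smap m n F (fun i j le_ij => fmap F (le_ij : @hom (ordcat m) i j)).

Lemma ordmapK m n (t : smap m n) : smap_of (ordmap t) = t.
Proof. exact: smap_eq. Qed.

Lemma smap_ofK m n (F : functor (ordcat m) (ordcat n)) : ordmap (smap_of F) = F.
Proof.
by apply: functor_eq => // i j le_ij; congr Arrow; apply: bool_irrelevance.
Qed.

(** With [nerve_join] this is the isomorphism expressing that the nerve preserves products; the
    nerve of the ordinal [n] is the [n]-simplex, since functors between ordinals are
    order-preserving maps. *)
Program Definition nerve_split (C : category) n :
    sset_map (nerve (prodcat C (ordcat n))) (ssprod (nerve C) (simplex n)) :=
  @SSetMap (nerve (prodcat C (ordcat n))) (ssprod (nerve C) (simplex n))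
    (fun _ s => (fcomp (prodfst _ _) s, smap_of (fcomp (prodsnd _ _) s))) _.
Next Obligation. by congr pair; apply: functor_eq. Qed.

Program Definition nerve_join (C : category) n :
    sset_map (ssprod (nerve C) (simplex n)) (nerve (prodcat C (ordcat n))) :=
  @SSetMap (ssprod (nerve C) (simplex n)) (nerve (prodcat C (ordcat n)))
    (fun _ x => pairing x.1 (ordmap x.2)) _.
Next Obligation.
by apply: functor_eq => // i j le_ij; congr (Arrow (_, _)).
Qed.

Lemma nerve_joinK (C : category) n :
  sscomp (nerve_split C n) (nerve_join C n) = ssid _.
Proof.
apply: sset_map_eq => m [s t] /=; congr pair; last exact: smap_eq.
exact: functor_eq.
Qed.

Lemma nerve_splitK (C : category) n :
  sscomp (nerve_join C n) (nerve_split C n) = ssid _.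
Proof.
apply: sset_map_eq => m s /=; apply: functor_eq => [i|i j le_ij] /=.
  by case: (s i).
move: (s i) (s j) (fmap s le_ij) => [? ?] [? ?] [f g] /=.
by congr (@Arrow (prodcat C (ordcat n)) (_, _) (_, _) (f, _));
  apply: bool_irrelevance.
Qed.

(** * Homotopies between nerves *)

Program Definition constf (C D : category) (d : D) : functor C D :=
  @Functor C D (fun _ => d) (fun _ _ _ => idm d) (fun _ => erefl) _.
Next Obligation. by rewrite comp_idl. Qed.

Definition level (C : category) n (i : 'I_n.+1) : functor C (prodcat C (ordcat n)) :=
  pairing (fid C) (@constf C (ordcat n) i).

Lemma nerve_join_level (C : category) (i : 'I_2) :
  sscomp (nerve_join C 1) (sspair (ssid (nerve C)) (const_vertex (nerve C) i)) =
  nerve_map (level C i).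
Proof.
by apply: sset_map_eq => m s; apply: functor_eq.
Qed.

Program Definition level_trans (C D : category) n
    (Phi : functor (prodcat C (ordcat n)) D) (i j : 'I_n.+1)
    (le_ij : (i <= j)%N) :
    nattrans (fcomp Phi (level C i)) (fcomp Phi (level C j)) :=
  @Nattrans C D (fcomp Phi (level C i)) (fcomp Phi (level C j))
    (fun x => @fmap _ _ Phi (x, i) (x, j) (idm x, le_ij)) _.
Next Obligation.
rewrite -!fmap_comp; congr (fmap Phi (_, _)); last exact: bool_irrelevance.
by rewrite /= comp_idl comp_idr.
Qed.

(** By fullness of the nerve the homotopy comes from a functor on the product of [C] with the
    ordinal 1. Its restrictions to the two levels are [F] and [G], and the morphism 0 to 1 gives the
    transformation. *)
Lemma homotopy_nat_iso (C D : category) (iD : inverses D) (F G : functor C D) :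
  homotopy (nerve_map F) (nerve_map G) -> nat_isomorphic F G.
Proof.
case=> h [hF hG]; pose Phi := nerve_functor (sscomp h (nerve_split C 1)).
have hE : h = sscomp (nerve_map Phi) (nerve_join C 1).
  by rewrite nerve_functorK -sscompA nerve_joinK sscomp_idr.
have -> : F = fcomp Phi (level C (ord0 : 'I_2)).
  by apply: nerve_map_inj; rewrite -hF hE -sscompA nerve_join_level nerve_map_comp.
have -> : G = fcomp Phi (level C (ord_max : 'I_2)).
  by apply: nerve_map_inj; rewrite -hG hE -sscompA nerve_join_level nerve_map_comp.
exact: (nat_iso iD (level_trans Phi (isT : (ord0 : 'I_2) <= ord_max)%N)).
Qed.

Lemma homotopic_nat_iso (C D : category) (iD : inverses D) (F G : functor C D) :
  homotopic (nerve_map F) (nerve_map G) -> nat_isomorphic F G.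
Proof.
(* The endpoints are generalised to arbitrary maps, so that induction on the generated relation is
   possible. *)
move: {-1}(nerve_map F) {-1}(nerve_map G) (erefl (nerve_map F)) (erefl (nerve_map G)).
move=> a b ea eb ab; elim: ab F G ea eb => {a b}.
- by move=> f g fg F G eF eG; apply: (homotopy_nat_iso iD); rewrite eF eG.
- move=> f F G <- /nerve_map_inj ->; exact: (nat_iso iD (nid F)).
- by move=> f g _ IH F G eF eG; apply: (nat_iso_sym iD); apply: IH.
- move=> f g h _ IH1 _ IH2 F G eF eG.
  (* The intermediate map [g] is the nerve of a functor, again by fullness. *)
  apply: (nat_iso_trans iD (G := nerve_functor g)).
    by apply: IH1; rewrite ?nerve_functorK.
  by apply: IH2; rewrite ?nerve_functorK.
Qed.

Section NatIsoHomotopy.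
Variables (C D : category) (iD : inverses D) (F G : functor C D).
Variable a : nattrans F G.

Let ob (x : prodcat C (ordcat 1)) : D := if x.2 == ord0 then F x.1 else G x.1.

Let b (x : prodcat C (ordcat 1)) : hom (F x.1) (ob x) :=
  match x.2 == ord0 as c return hom (F x.1) (if c then F x.1 else G x.1) with
  | true => idm (F x.1) | false => a x.1 end.

(** The family [b] is the identity at level 0 and [a] at level 1. Conjugating [F] by it gives [F]
    and [G] on the two levels, and functoriality needs no case distinction on levels because the
    inverses cancel. *)
Program Definition cylinder_functor : functor (prodcat C (ordcat 1)) D :=
  @Functor (prodcat C (ordcat 1)) D ob
    (fun x y f => comp (b y) (comp (fmap F f.1) (inv iD (b x)))) _ _.
Next Obligation. by rewrite fmap_id comp_idl comp_invr. Qed.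
Next Obligation.
rewrite fmap_comp -!comp_assoc (comp_assoc (inv iD (b y))) comp_invl.
by rewrite comp_idl.
Qed.

Lemma nat_trans_homotopy : homotopy (nerve_map F) (nerve_map G).
Proof.
exists (sscomp (nerve_map cylinder_functor) (nerve_join C 1)).
rewrite -!sscompA !nerve_join_level -!nerve_map_comp.
split; congr nerve_map; apply: functor_eq => // x y f /=; rewrite /b /=.
  by rewrite inv_idm comp_idr comp_idl.
by rewrite comp_assoc ncompP -comp_assoc comp_invr comp_idr.
Qed.

End NatIsoHomotopy.

Lemma nat_iso_homotopic (C D : category) (iD : inverses D) (F G : functor C D) :
  nat_isomorphic F G -> homotopic (nerve_map F) (nerve_map G).
Proof. by case=> a _; apply/homotopic_step/nat_trans_homotopy. Qed.

Lemma equivalence_weq (C D : category) (iC : inverses C) (iD : inverses D)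
    (F : functor C D) : equivalence F -> weq (nerve_map F).
Proof.
case=> G [a b]; apply: (@hoequiv_weq _ _ _ (nerve_map G)).
  rewrite -nerve_map_comp -nerve_map_id; apply: homotopic_sym.
  exact: nat_iso_homotopic.
by rewrite -nerve_map_comp -nerve_map_id; apply: nat_iso_homotopic.
Qed.

(** * Nerves of groupoids are Kan complexes *)

Lemma horn_eq n (k : 'I_n.+1) m (s t : horn k m) :
  proj1_sig s = proj1_sig t -> s = t.
Proof. by case: s t => [s ps] [t pt] /= e; apply: eq_exist. Qed.

(** In dimension at least 2 this supplies the omitted vertex showing that every vertex, and every
    edge through [k], lies in the horn. *)
Lemma exists_third n (i j : 'I_n.+3) : exists2 l : 'I_n.+3, l != i & l != j.
Proof.
have lt : (#|[set i; j]| < #|[set: 'I_n.+3]|)%N.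
  by rewrite cards2 cardsT card_ord; case: (i != j).
have /subsetPn[l _] : ~~ ([set: 'I_n.+3] \subset [set i; j]).
  by apply: contraL lt => /subset_leq_card; rewrite -leqNgt.
by rewrite !inE negb_or => /andP[? ?]; exists l.
Qed.

Lemma inv_inv (C : category) (i : inverses C) (x y : C) (f : hom x y) :
  inv i (inv i f) = f.
Proof. by apply: inv_unique; rewrite comp_invr. Qed.

Lemma not_leq_leq (i j : nat) : ~ (i <= j)%N -> (j <= i)%N.
Proof. by move/negP; rewrite -ltnNge => /ltnW. Qed.

Section HornFilling.
Variables (C : category) (iC : inverses C) (n : nat) (k : 'I_n.+3).
Variable h : sset_map (horn k) (nerve C).

Lemma vertex_in_horn (i : 'I_n.+3) : in_horn k (sconst 0 i).
Proof. by have [l lk li] := exists_third k i; exists l => // a; rewrite eq_sym. Qed.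

Definition horn_vertex (i : 'I_n.+3) : C :=
  h 0 (exist _ (sconst 0 i) (vertex_in_horn i)) ord0.

Lemma horn_vertexE m (t : horn k m) a :
  h m t a = horn_vertex (proj1_sig t a).
Proof. by rewrite nerve_map_vertex; congr (h 0 _ _); apply: horn_eq; apply: smap_eq. Qed.

Lemma edge_in_horn (i j : 'I_n.+3) (le_ij : (i <= j)%N) :
  (i == k) || (j == k) -> in_horn k (sedge le_ij).
Proof.
move=> ijk; have [l li lj] := exists_third i j.
exists l; first by case/orP: ijk => /eqP <-.
by move=> a /=; case: ifP => _; rewrite eq_sym.
Qed.

(** Only edges through [k] are taken: in dimension 2 the edge opposite [k] is absent from the
    horn. *)
Definition horn_edge (i j : 'I_n.+3) (le_ij : (i <= j)%N)
    (ijk : (i == k) || (j == k)) : hom (horn_vertex i) (horn_vertex j) :=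
  let e : horn k 1 := exist _ (sedge le_ij) (edge_in_horn le_ij ijk) in
  retype (horn_vertexE e ord0) (horn_vertexE e ord_max) (fmap (h 1 e) le01).

Lemma horn_arrow_eq m m' (t : horn k m) (t' : horn k m') (a b : ordcat m)
    (a' b' : ordcat m') (le_ab : hom a b) (le_ab' : hom a' b') :
  proj1_sig t a = proj1_sig t' a' -> proj1_sig t b = proj1_sig t' b' ->
  Arrow (fmap (h m t) le_ab) = Arrow (fmap (h m' t') le_ab').
Proof.
move=> ea eb; rewrite !nerve_map_edge; congr (edge (h 1 _)).
by apply: horn_eq; apply: smap_eq => c /=; case: ifP.
Qed.

Lemma horn_edgeE m (t : horn k m) (a b : ordcat m) (le_ab : hom a b)
    (i j : 'I_n.+3) (le_ij : (i <= j)%N) ijk : proj1_sig t a = i -> proj1_sig t b = j ->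
  Arrow (fmap (h m t) le_ab) = Arrow (@horn_edge i j le_ij ijk).
Proof. by move=> ti tj; rewrite arrow_retype; apply: horn_arrow_eq. Qed.

(** The edge of the horn between [k] and [i], inverted when [i < k]. Setting
    s(i <= j) = spoke j o (spoke i)^-1 is functorial for free. *)
Definition spoke (i : 'I_n.+3) : hom (horn_vertex k) (horn_vertex i) :=
  match @idP (k <= i)%N with
  | ReflectT le_ki => horn_edge le_ki (introT orP (or_introl (eqxx k)))
  | ReflectF nle_ki => inv iC (horn_edge (not_leq_leq nle_ki)
      (introT orP (or_intror (eqxx k))))
  end.

Lemma spoke_ge m (t : horn k m) (a b : ordcat m) (le_ab : hom a b) :
  proj1_sig t a = k ->
  Arrow (spoke (proj1_sig t b)) = Arrow (fmap (h m t) le_ab).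
Proof.
move=> ta; have le_kb : (k <= proj1_sig t b)%N by rewrite -{1}ta; apply: sfun_homo.
by rewrite /spoke; case: {-}_ / idP => // le; apply/esym/horn_edgeE.
Qed.

(** The inequality is strict because at [k] itself [spoke] takes its other branch, without
    inversion. *)
Lemma spoke_lt m (t : horn k m) (a b : ordcat m) (le_ab : hom a b) :
  proj1_sig t b = k -> (proj1_sig t a < k)%N ->
  Arrow (spoke (proj1_sig t a)) = Arrow (inv iC (fmap (h m t) le_ab)).
Proof.
move=> tb lt_ak; rewrite /spoke; case: {-}_ / idP => [le|nle].
  by have := leq_trans lt_ak le; rewrite ltnn.
by apply/arrow_inv/esym/horn_edgeE.
Qed.

Program Definition striple N (p q r : 'I_N.+1) (pq : (p <= q)%N) (qr : (q <= r)%N) :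
    smap 2 N :=
  @Smap 2 N (fun a => if val a == 0 then p else if val a == 1 then q else r) _.
Next Obligation.
by move=> [[|[|[|//]]] ?] [[|[|[|//]]] ?] //= _; apply: leq_trans qr.
Qed.

(** The simplex [t] misses some [l] other than [k], so the triangle on [t a], [t b] and [k] misses
    [l] as well and lies in the horn. Its image is a commutative triangle, which is solved for the
    edge from [t a] to [t b]; the three cases are [k] as first, middle and last vertex. *)
Lemma horn_spokes m (t : horn k m) (a b : ordcat m) (le_ab : hom a b) :
  Arrow (fmap (h m t) le_ab) =
  Arrow (comp (spoke (proj1_sig t b)) (inv iC (spoke (proj1_sig t a)))).
Proof.
case: (proj2_sig t) => l lk lt.
have triple (p q r : 'I_n.+3) (pq : (p <= q)%N) (qr : (q <= r)%N) : p != l -> q != l ->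
    r != l -> in_horn k (striple pq qr).
  by move=> pl ql rl; exists l => // c /=; case: ifP => // _; case: ifP.
have le_t : (proj1_sig t a <= proj1_sig t b)%N by apply: sfun_homo.
have kl : k != l by rewrite eq_sym.
pose i0 : ordcat 2 := ord0; pose i1 : ordcat 2 := @Ordinal 3 1 isT.
pose i2 : ordcat 2 := ord_max.
have le12 : @hom (ordcat 2) i1 i2 by [].
have le01 : @hom (ordcat 2) i0 i1 by [].
have le02 := comp le12 le01.
have [le_ka|lt_ak] := leqP k (proj1_sig t a).
  pose T : horn k 2 := exist _ _ (triple _ _ _ le_ka le_t kl (lt a) (lt b)).
  have := comp_eq_invr iC (esym (fmap_comp (h 2 T) le12 le01)).
  move/(congr1 (@Arrow _ _ _)); rewrite (horn_arrow_eq (t' := t) _ le_ab) // => ->.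
  apply: arrow_comp; first by apply: arrow_inv; rewrite -(@spoke_ge _ T).
  by rewrite -(@spoke_ge _ T).
have [le_kb|lt_bk] := leqP k (proj1_sig t b).
  pose T : horn k 2 := exist _ _ (triple _ _ _ (ltnW lt_ak) le_kb (lt a) kl (lt b)).
  rewrite (horn_arrow_eq (t' := T) le_ab (comp le12 le01)) // fmap_comp.
  apply: arrow_comp; last by rewrite -(@spoke_ge _ T).
  by rewrite (arrow_inv iC (@spoke_lt _ T _ _ le01 _ _)) ?inv_inv.
pose T : horn k 2 := exist _ _ (triple _ _ _ le_t (ltnW lt_bk) (lt a) (lt b) kl).
have := comp_eq_invl iC (esym (fmap_comp (h 2 T) le12 le01)).
move/(congr1 (@Arrow _ _ _)); rewrite (horn_arrow_eq (t' := t) _ le_ab) // => ->.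
apply: arrow_comp; last by rewrite -(@spoke_lt _ T).
by rewrite (arrow_inv iC (@spoke_lt _ T _ _ (comp le12 le01) _ _)) ?inv_inv.
Qed.

Program Definition horn_filler : functor (ordcat n.+2) C :=
  @Functor (ordcat n.+2) C horn_vertex
    (fun i j _ => comp (spoke j) (inv iC (spoke i))) _ _.
Next Obligation. by rewrite comp_invr. Qed.
Next Obligation.
by rewrite -comp_assoc (comp_assoc (inv iC (spoke y))) comp_invl comp_idl.
Qed.

Lemma horn_fillerP m (t : horn k m) :
  fcomp horn_filler (ordmap (proj1_sig t)) = h m t.
Proof.
apply: functor_eq => [a|a b le_ab] /=; first by rewrite horn_vertexE.
by rewrite horn_spokes.
Qed.

End HornFilling.

Program Definition simplex_of (X : sset) n (x : X n) : sset_map (simplex n) X :=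
  @SSetMap (simplex n) X (fun m t => sact t x) _.
Next Obligation. by rewrite -sact_comp. Qed.

Lemma nerve_kan (C : category) (iC : inverses C) : kan (nerve C).
Proof.
have I2 (x y l : 'I_2) : l != x -> y != l -> x = y.
  by case: x y l => [[|[|//]] ?] [[|[|//]] ?] [[|[|//]] ?] //= _ _; apply: val_inj.
move=> [|n] k h; last first.
  exists (simplex_of (horn_filler iC h : nerve C n.+2)).
  by apply: sset_map_eq => m t; apply: horn_fillerP.
(* In dimension 1 the horn is the single vertex [k] with its degeneracies, and the degenerate edge
   at its image is a filler. *)
have kconst : in_horn k (sconst 0 k).
  have [l lk] : exists l : 'I_2, l != k.
    by case: (eqVneq k ord0) => [->|k0]; [exists ord_max|exists ord0; rewrite eq_sym].
  by exists l => // a; rewrite eq_sym.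
exists (simplex_of (sact (sconst 1 ord0) (h 0 (exist _ (sconst 0 k) kconst)))).
apply: sset_map_eq => m [t ht].
rewrite -[LHS]/(sact t (sact (sconst 1 ord0) (h 0 (exist _ (sconst 0 k) kconst)))).
rewrite -sact_comp -smap_nat; congr (h m _); apply: horn_eq; apply: smap_eq => a /=.
by case: ht => l lk /(_ a); apply: I2.
Qed.

(** Both nerves are Kan, so they may serve as targets. Surjectivity for the nerve of [C] extends the
    identity to the nerve of some [G] with [GF] homotopic to the identity. Then [FGF] is homotopic
    to [F], and injectivity for the nerve of [D] makes [FG] homotopic to the identity. *)
Lemma weq_equivalence (C D : category) (iC : inverses C) (iD : inverses D)
    (F : functor C D) : weq (nerve_map F) -> equivalence F.
Proof.
move=> wF; have [_ /(_ (ssid _)) [a aF]] := wF _ (nerve_kan iC).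
have [inj _] := wF _ (nerve_kan iD).
pose G := nerve_functor a; have aE : a = nerve_map G by rewrite nerve_functorK.
have {aE} GF : homotopic (nerve_map (fcomp G F)) (nerve_map (fid C)).
  by rewrite nerve_map_comp -aE nerve_map_id.
exists G; split; first by apply: (homotopic_nat_iso iC); apply: homotopic_sym.
apply: (homotopic_nat_iso iD); apply: inj.
have := homotopic_post (nerve_map F) GF.
rewrite -!nerve_map_comp !fcompA.
by rewrite (_ : fcomp F (fid C) = fcomp (fid D) F) //; apply: functor_eq.
Qed.

(** * Function complexes of nerves *)

Lemma ccat_map_eq (C D : ccategory) (F G : ccat_map C D) :
  (forall n, F n = G n) -> F = G.
Proof.
case: F => F eF; case: G => G eG /= e.
have {}e : F = G by apply: functional_extensionality_dep.
by subst G; rewrite (Prop_irrelevance eF eG).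
Qed.

Lemma ccat_trans_arrow (C D : ccategory) (E F E' F' : ccat_map C D)
    (a : ccat_trans E F) (a' : ccat_trans E' F') : E = E' -> F = F' ->
  (forall n x, Arrow (a n x) = Arrow (a' n x)) ->
  @Arrow (map_category C D) _ _ a = @Arrow (map_category C D) _ _ a'.
Proof.
move=> eE eF; subst E' F' => e; congr Arrow.
by apply: ccat_trans_eq => n x; apply: arrow_inj.
Qed.

Lemma ccm_arrow (C D : ccategory) (F : ccat_map C D) m n (t : smap m n)
    (x y : C m) (f : hom x y) :
  Arrow (fmap (F n) (fmap (cc_map C t) f)) = Arrow (fmap (cc_map D t) (fmap (F m) f)).
Proof. exact: (functor_arrow f (ccm_nat F t)). Qed.

Definition prodmap (C : ccategory) n m p (t : smap m p) :
    functor (prodcat (C m) (ordcat n)) (prodcat (C p) (ordcat n)) :=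
  pairing (fcomp (cc_map C t) (prodfst _ _)) (prodsnd _ _).

(** The second component of a morphism is a proof of an inequality, and such proofs are unique. *)
Lemma fmap_prodcat (C D : category) n (Phi : functor (prodcat C (ordcat n)) D)
    (x y : prodcat C (ordcat n)) (f g : hom x y) :
  f.1 = g.1 -> fmap Phi f = fmap Phi g.
Proof.
by case: f g => f a [g b] /= ->; rewrite (bool_irrelevance a b).
Qed.

Section Curry.
Variables (C G : ccategory).

(** The exponential law, level by level: a chain of [n] composable transformations is a functor on
    the product with the ordinal [n]. *)
Program Definition uncurry n (s : functor (ordcat n) (map_category C G)) m :
    functor (prodcat (C m) (ordcat n)) (G m) :=
  @Functor (prodcat (C m) (ordcat n)) (G m)
    (fun x => (s x.2 : ccat_map C G) m x.1)
    (fun x y f => comp (fmap ((s y.2 : ccat_map C G) m) f.1)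
                       ((fmap s f.2 : ccat_trans _ _) m x.1)) _ _.
Next Obligation. by rewrite fmap_id comp_idl (fmap_id s). Qed.
Next Obligation.
rewrite fmap_comp (fmap_comp s) /= -!comp_assoc; congr comp.
by rewrite !comp_assoc ncompP.
Qed.

Lemma uncurry_nat n (s : functor (ordcat n) (map_category C G)) m p (t : smap m p) :
  fcomp (cc_map G t) (uncurry s m) = fcomp (uncurry s p) (prodmap C n t).
Proof.
apply: functor_eq => [x|x y f] /=; first by rewrite ccm_ob.
rewrite fmap_comp; apply: arrow_comp; first exact: cct_nat.
by rewrite ccm_arrow.
Qed.

Lemma nerve_join_nat n m p (t : smap m p) :
  sscomp (nerve_join (C p) n)
    (tensor_map (nerve_map (cc_map C t)) (ssid (simplex n))) =
  sscomp (nerve_map (prodmap C n t)) (nerve_join (C m) n).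
Proof. by apply: sset_map_eq => k x; apply: functor_eq. Qed.

Lemma nerve_split_nat n m p (t : smap m p) :
  sscomp (tensor_map (nerve_map (cc_map C t)) (ssid (simplex n)))
    (nerve_split (C m) n) =
  sscomp (nerve_split (C p) n) (nerve_map (prodmap C n t)).
Proof.
by apply: sset_map_eq => k x; congr pair; apply: functor_eq.
Qed.

Program Definition nerve_cshom_simplex n
    (s : functor (ordcat n) (map_category C G)) :
    csspace_map (cstensor (cnerve C) (simplex n)) (cnerve G) :=
  @CSSpaceMap (cstensor (cnerve C) (simplex n)) (cnerve G)
    (fun m => sscomp (nerve_map (uncurry s m)) (nerve_join (C m) n)) _.
Next Obligation.
rewrite -sscompA nerve_join_nat !sscompA -!nerve_map_comp.
by rewrite uncurry_nat.
Qed.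

Program Definition nerve_cshom :
    sset_map (nerve (map_category C G)) (cshom (cnerve C) (cnerve G)) :=
  @SSetMap (nerve (map_category C G)) (cshom (cnerve C) (cnerve G))
    nerve_cshom_simplex _.
Next Obligation.
by apply: csspace_map_eq => p; apply: sset_map_eq => k y; apply: functor_eq.
Qed.

Section CurryFamily.
Variables (n : nat) (Psi : forall m, functor (prodcat (C m) (ordcat n)) (G m)).
Hypothesis Psi_nat : forall m p (t : smap m p),
  fcomp (cc_map G t) (Psi m) = fcomp (Psi p) (prodmap C n t).

Program Definition curry_ob (i : 'I_n.+1) : ccat_map C G :=
  @CCatMap C G (fun m => fcomp (Psi m) (level (C m) i)) _.
Next Obligation.
by rewrite [RHS]fcompA Psi_nat -!fcompA; congr fcomp; apply: functor_eq.
Qed.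

Program Definition curry_hom (i j : 'I_n.+1) (le_ij : (i <= j)%N) :
    ccat_trans (curry_ob i) (curry_ob j) :=
  @CCatTrans C G (curry_ob i) (curry_ob j)
    (fun m => level_trans (Psi m) le_ij) _.
Next Obligation.
have := @functor_arrow (prodcat (C m) (ordcat n)) _ _ _ (x, i) (x, j)
  (idm x, le_ij) (Psi_nat t).
by rewrite /= fmap_id.
Qed.

Program Definition curry : functor (ordcat n) (map_category C G) :=
  @Functor (ordcat n) (map_category C G) curry_ob curry_hom _ _.
Next Obligation. apply: ccat_trans_eq => m z; rewrite /= -fmap_id.
exact: fmap_prodcat. Qed.
Next Obligation.
apply: ccat_trans_eq => m w; rewrite /= -fmap_comp.
by apply: fmap_prodcat; rewrite /= comp_idl.
Qed.

Lemma curryK m : uncurry curry m = Psi m.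
Proof.
apply: functor_eq => [[x i]|[x i] [y j] [f le_ij]] //=.
by rewrite -fmap_comp; congr Arrow; apply: fmap_prodcat; rewrite /= comp_idr.
Qed.

End CurryFamily.

Section CurryOf.
Variables (n : nat) (c : cshom (cnerve C) (cnerve G) n).

Let c' : csspace_map (cstensor (cnerve C) (simplex n)) (cnerve G) := c.

(** Because the nerve preserves products and is full, each level of a simplex of the function
    complex is the nerve of a functor. Currying this family inverts [nerve_cshom]. *)
Definition cshom_family m : functor (prodcat (C m) (ordcat n)) (G m) :=
  nerve_functor (sscomp (c' m) (nerve_split (C m) n)).

Lemma cshom_family_nat m p (t : smap m p) :
  fcomp (cc_map G t) (cshom_family m) = fcomp (cshom_family p) (prodmap C n t).
Proof.
apply: nerve_map_inj; rewrite !nerve_map_comp !nerve_functorK sscompA.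
by rewrite -(csm_nat c' t) -!sscompA nerve_split_nat.
Qed.

Definition cshom_nerve : functor (ordcat n) (map_category C G) :=
  curry cshom_family_nat.

Lemma cshom_nerveK : nerve_cshom n cshom_nerve = c.
Proof.
apply: csspace_map_eq => m /=; rewrite curryK nerve_functorK.
by rewrite -sscompA nerve_joinK sscomp_idr.
Qed.

End CurryOf.

Lemma nerve_cshomK n (s : functor (ordcat n) (map_category C G)) :
  cshom_nerve (nerve_cshom n s) = s.
Proof.
have fam m : cshom_family (nerve_cshom n s) m = uncurry s m.
  apply: nerve_map_inj; rewrite nerve_functorK /= -sscompA.
  by rewrite nerve_splitK sscomp_idr.
have ob i : curry_ob (cshom_family_nat (nerve_cshom n s)) i = s i.
  apply: ccat_map_eq => m /=; rewrite fam; apply: functor_eq => //= x y f.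
  by rewrite (bool_irrelevance (leqnn i) (idm (i : ordcat n))) (fmap_id s) /= comp_idr.
apply: functor_eq => [i|i j le_ij]; first exact: ob.
apply: ccat_trans_arrow => [||m x /=]; [exact: ob|exact: ob|].
have := @functor_arrow (prodcat (C m) (ordcat n)) _ _ _ (x, i) (x, j)
  (idm x, le_ij) (fam m).
by rewrite /= fmap_id comp_idl.
Qed.

Lemma nerve_cshom_weq : weq nerve_cshom.
Proof.
refine (@bij_weq _ _ nerve_cshom (@cshom_nerve) _ _) => [n s|n c].
  exact: nerve_cshomK.
exact: cshom_nerveK.
Qed.

End Curry.

(** * Functors induced by composition, and their function complexes *)

Program Definition ccm_comp (C D E : ccategory) (G : ccat_map D E)
    (F : ccat_map C D) : ccat_map C E :=
  @CCatMap C E (fun n => fcomp (G n) (F n)) _.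
Next Obligation. by rewrite -fcompA ccm_nat fcompA ccm_nat -fcompA. Qed.

Program Definition post_trans (C G H : ccategory) (j : ccat_map G H)
    (E F : ccat_map C G) (a : ccat_trans E F) :
    ccat_trans (ccm_comp j E) (ccm_comp j F) :=
  @CCatTrans C H (ccm_comp j E) (ccm_comp j F)
    (fun n => @Nattrans (C n) (H n) (fcomp (j n) (E n)) (fcomp (j n) (F n))
       (fun x => fmap (j n) (a n x)) _) _.
Next Obligation. by rewrite -!fmap_comp ncompP. Qed.
Next Obligation. by rewrite -ccm_arrow; apply/arrow_fmap/cct_nat. Qed.

Program Definition post_functor (C G H : ccategory) (j : ccat_map G H) :
    functor (map_category C G) (map_category C H) :=
  @Functor (map_category C G) (map_category C H)
    (ccm_comp j) (fun E F a => post_trans j a) _ _.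
Next Obligation. by apply: ccat_trans_eq => n y /=; rewrite fmap_id. Qed.
Next Obligation. by apply: ccat_trans_eq => n w /=; rewrite fmap_comp. Qed.

Program Definition pre_trans (B C G : ccategory) (p : ccat_map B C)
    (E F : ccat_map C G) (a : ccat_trans E F) :
    ccat_trans (ccm_comp E p) (ccm_comp F p) :=
  @CCatTrans B G (ccm_comp E p) (ccm_comp F p)
    (fun n => @Nattrans (B n) (G n) (fcomp (E n) (p n)) (fcomp (F n) (p n))
       (fun x => a n (p n x)) _) _.
Next Obligation. exact: ncompP. Qed.
Next Obligation. by rewrite cct_nat; case: _ / (ccm_ob p t x). Qed.

Program Definition pre_functor (B C G : ccategory) (p : ccat_map B C) :
    functor (map_category C G) (map_category B G) :=
  @Functor (map_category C G) (map_category B G)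
    (fun E => ccm_comp E p) (fun E F a => pre_trans p a) _ _.
Next Obligation. exact: ccat_trans_eq. Qed.
Next Obligation. exact: ccat_trans_eq. Qed.

Lemma nerve_cshom_post (C G H : ccategory) (j : ccat_map G H) :
  sscomp (cshom_post (cnerve C) (cnerve_map j)) (nerve_cshom C G) =
  sscomp (nerve_cshom C H) (nerve_map (post_functor C j)).
Proof.
apply: sset_map_eq => n s; apply: csspace_map_eq => m; apply: sset_map_eq => k x.
by apply: functor_eq => //= a b f; rewrite fmap_comp.
Qed.

Lemma nerve_cshom_pre (B C G : ccategory) (p : ccat_map B C) :
  sscomp (cshom_pre (cnerve G) (cnerve_map p)) (nerve_cshom C G) =
  sscomp (nerve_cshom B G) (nerve_map (pre_functor G p)).
Proof.
apply: sset_map_eq => n s; apply: csspace_map_eq => m; apply: sset_map_eq => k x.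
exact: functor_eq.
Qed.

Lemma cshom_pre_bij_weq (X Y Z : csspace) (i : csspace_map X Y)
    (r : csspace_map Y X) :
  cscomp r i = csid X -> cscomp i r = csid Y -> weq (cshom_pre Z i).
Proof.
move=> ri ir; apply: (@bij_weq _ _ _ (cshom_pre Z r)) => n c.
  apply: csspace_map_eq => m; apply: sset_map_eq => k [y v].
  exact: (congr1 (fun h : csspace_map Y Y =>
    (c : csspace_map (cstensor Y _) Z) m k (h m k y, v)) ir).
apply: csspace_map_eq => m; apply: sset_map_eq => k [x v].
exact: (congr1 (fun h : csspace_map X X =>
  (c : csspace_map (cstensor X _) Z) m k (h m k x, v)) ri).
Qed.

(** * Descent data *)

Lemma scomp_sconst m n p (t : smap n p) (i : 'I_n.+1) :
  scomp t (sconst m i) = sconst m (t i).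
Proof. exact: smap_eq. Qed.

Lemma cc_map_compA (C : ccategory) l m n (t : smap m n) (u : smap l m)
    (x y : C l) (f : hom x y) :
  Arrow (fmap (cc_map C t) (fmap (cc_map C u) f)) =
  Arrow (fmap (cc_map C (scomp t u)) f).
Proof. exact: (functor_arrow f (esym (cc_map_comp C t u))). Qed.

Section PostEquivalence.
Variables (G H : cgroupoid) (j : ccat_map G H).
Hypotheses (jfull : forall n, full (j n)) (jfaithful : forall n, faithful (j n)).

Lemma post_faithful (C : ccategory) : faithful (post_functor C j).
Proof.
move=> E F f g e; apply: ccat_trans_eq => n x; apply: jfaithful.
exact: (congr1 (fun h : ccat_trans _ _ => h n x) e).
Qed.

Section PostLift.
Variables (C : ccategory) (E F : ccat_map C G).
Variable g : ccat_trans (ccm_comp j E) (ccm_comp j F).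

Program Definition post_lift_at n : nattrans (E n) (F n) :=
  @Nattrans (C n) (G n) (E n) (F n) (fun x => full_lift (@jfull n) (g n x)) _.
Next Obligation.
by apply: jfaithful; rewrite !fmap_comp !full_liftK; apply: (ncompP (g n)).
Qed.

Program Definition post_lift : ccat_trans E F :=
  @CCatTrans C G E F post_lift_at _.
Next Obligation.
apply: (faithful_arrow (@jfaithful n)); try by rewrite ccm_ob.
rewrite ccm_arrow !full_liftK; exact: (cct_nat g t x).
Qed.

End PostLift.

Lemma post_full (C : ccategory) : full (post_functor C j).
Proof.
move=> E F g; exists (post_lift g); apply: ccat_trans_eq => n x.
exact: (@full_liftK _ _ _ (@jfull n) (E n x) (F n x) _).
Qed.

Section PostEssurj.
Variables (E : ccat_map cordcat H) (x : G 0) (a : hom (j 0 x) (E 0 ord0)).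

(** All objects are images of the single object [x] along the vertex maps from 0 to [n]. Since [t]
    after the vertex [i] is the vertex [t i], compatibility with the structure maps is a strict
    equality, which separate choices in each degree would not give. *)
Definition descent_ob n (i : ordcat n) : G n := cc_map G (sconst 0 i) x.

Definition descent_iso n (i : ordcat n) : hom (j n (descent_ob i)) (E n i) :=
  retype (esym (ccm_ob j (sconst 0 i) x)) (esym (ccm_ob E (sconst 0 i) ord0))
    (fmap (cc_map H (sconst 0 i)) a).

Lemma descent_iso_nat m n (t : smap m n) (i : ordcat m) :
  Arrow (fmap (cc_map H t) (descent_iso i)) = Arrow (descent_iso (t i : ordcat n)).
Proof.
rewrite arrow_retype (arrow_fmap _ (arrow_retype _ _ _)).
by rewrite cc_map_compA scomp_sconst.
Qed.

Definition descent_functor n : functor (ordcat n) (G n) :=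
  lift_functor (cg_inv H n) (@jfull n) (@jfaithful n) (@descent_iso n).

Program Definition descent : ccat_map cordcat G :=
  @CCatMap cordcat G descent_functor _.
Next Obligation.
have ob i : descent_ob (t i : ordcat n) = cc_map G t (descent_ob i).
  by rewrite /descent_ob -scomp_sconst cc_map_comp.
apply: functor_eq => [i|i k f]; first exact: ob.
(* After applying [j], both morphisms become conjugates of morphisms of [E] by [descent_iso], and
   each factor is natural in [t]. *)
apply: (faithful_arrow (@jfaithful n)); try exact: ob.
rewrite [RHS]ccm_arrow /= !full_liftK !fmap_comp (fmap_inv _ (cg_inv H n)).
apply: arrow_comp; last by apply/arrow_inv/esym/descent_iso_nat.
apply: arrow_comp; first exact/esym/descent_iso_nat.
exact: (ccm_arrow E t f).
Qed.

Program Definition descent_trans : ccat_trans (ccm_comp j descent) E :=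
  @CCatTrans cordcat H (ccm_comp j descent) E
    (fun n => lift_functor_trans (cg_inv H n) (@jfull n) (@jfaithful n)
       (@descent_iso n)) _.
Next Obligation. exact: descent_iso_nat. Qed.

End PostEssurj.

(** Every object [E n i] is the image of [E 0 0] along the vertex [i], so a preimage up to
    isomorphism of that one object determines the whole lift. *)
Lemma post_essurj : essurj (j 0) -> essurj (post_functor cordcat j).
Proof.
move=> je E; have [x [a _]] := je (E 0 ord0).
by exists (descent a), (descent_trans a).
Qed.

End PostEquivalence.

Lemma post_equivalence (G H : cgroupoid) (j : ccat_map G H) :
  cg_weq j -> equivalence (post_functor cordcat j).
Proof.
move=> jw; have jeq n : [/\ full (j n), faithful (j n) & essurj (j n)].
  apply: equivalence_ff (cg_inv G n) (cg_inv H n) _ _.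
  exact: weq_equivalence (cg_inv G n) (cg_inv H n) _ (jw n).
have jfull n : full (j n) by case: (jeq n).
have jfaithful n : faithful (j n) by case: (jeq n).
apply: (ff_equivalence (gpd_inv (delta_groupoid G)) (gpd_inv (delta_groupoid H))).
- exact: post_full.
- exact: post_faithful.
- by apply: post_essurj => //; case: (jeq 0).
Qed.

(** * Global sections *)

(** The nerve of this category is a point, so maps from the constant cosimplicial category [cunit]
    model maps from the terminal cosimplicial space. *)
Definition unitcat : category :=
  @Category unit (fun _ _ => unit) (fun _ => tt) (fun _ _ _ _ _ => tt)
    (fun _ _ f => match f with tt => erefl end)
    (fun _ _ f => match f with tt => erefl end) (fun _ _ _ _ _ _ _ => erefl).

Program Definition cunit : ccategory :=
  @CCategory (fun _ => unitcat) (fun _ _ _ => fid unitcat) _ _.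
Next Obligation. by []. Qed.
Next Obligation. exact: functor_eq. Qed.

Program Definition to_cunit (C : ccategory) : ccat_map C cunit :=
  @CCatMap C cunit (fun n => @constf (C n) unitcat tt) _.
Next Obligation. exact: functor_eq. Qed.

Program Definition section_map (H : ccategory) (x : section_ob H) :
    ccat_map cunit H :=
  @CCatMap cunit H (fun n => @constf unitcat (H n) (x n)) _.
Next Obligation.
apply: functor_eq => [u|u v f] /=; first by rewrite so_nat.
by rewrite fmap_id; apply: arrow_idm; rewrite so_nat.
Qed.

Program Definition section_trans (H : ccategory) (x y : section_ob H)
    (f : section_hom x y) : ccat_trans (section_map x) (section_map y) :=
  @CCatTrans cunit H (section_map x) (section_map y)
    (fun n => @Nattrans unitcat (H n) (section_map x n) (section_map y n)
       (fun _ => f n) _) _.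
Next Obligation. by rewrite comp_idl comp_idr. Qed.
Next Obligation. exact: sh_nat. Qed.

Program Definition section_functor (H : ccategory) :
    functor (section_category H) (map_category cunit H) :=
  @Functor (section_category H) (map_category cunit H)
    (@section_map H) (@section_trans H) _ _.
Next Obligation. exact: ccat_trans_eq. Qed.
Next Obligation. exact: ccat_trans_eq. Qed.

Program Definition section_of (H : ccategory) (E : ccat_map cunit H) :
    section_ob H := @SectionOb H (fun n => E n tt) _.
Next Obligation. exact/esym/(ccm_ob E t). Qed.

Program Definition section_counit (H : ccategory) (E : ccat_map cunit H) :
    ccat_trans (section_map (section_of E)) E :=
  @CCatTrans cunit H (section_map (section_of E)) E
    (fun n => @Nattrans unitcat (H n) (section_map (section_of E) n) (E n)
       (fun u => match u return hom (E n tt) (E n u) with tt => idm _ end) _) _.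
Next Obligation.
by case: x y f => [] [] [] /=; rewrite comp_idl comp_idr (fmap_id (E n)).
Qed.
Next Obligation.
by case: x => /=; rewrite fmap_id; apply: arrow_idm; rewrite -(ccm_ob E t).
Qed.

Program Definition section_of_trans (H : ccategory) (x y : section_ob H)
    (a : ccat_trans (section_map x) (section_map y)) : section_hom x y :=
  @SectionHom H x y (fun n => a n tt) _.
Next Obligation. exact: (cct_nat a t tt). Qed.

Lemma section_equivalence (H : cgroupoid) : equivalence (section_functor H).
Proof.
apply: (ff_equivalence (gpd_inv (global_sections H)) (gpd_inv (map_groupoid cunit H))).
- move=> x y a; exists (section_of_trans a).
  by apply: ccat_trans_eq => n [].
- move=> x y f g e; apply: section_hom_eq => n.
  exact: (congr1 (fun h : ccat_trans (section_map x) (section_map y) =>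
    h n (tt : unitcat)) e).
- by move=> E; exists (section_of E), (section_counit E).
Qed.

Definition delta_section (H : ccategory) :
    functor (section_category H) (map_category cordcat H) :=
  fcomp (pre_functor H (to_cunit cordcat)) (section_functor H).

Lemma delta_section_faithful (H : ccategory) : faithful (delta_section H).
Proof.
move=> x y f g e; apply: section_hom_eq => n.
exact: (congr1 (fun h : ccat_trans (delta_section H x : ccat_map cordcat H)
  (delta_section H y : ccat_map cordcat H) => h n (ord0 : ordcat n)) e).
Qed.

Section DeltaSectionFull.
Variables (H : ccategory) (x y : section_ob H).
Variable a : ccat_trans (delta_section H x : ccat_map cordcat H)
  (delta_section H y : ccat_map cordcat H).

(** Both functors are constant on the ordinal, so naturality along the morphism from 0 to [i]
    equates the two components. A transformation is thus determined by its components at 0, which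
    form a morphism of sections. *)
Lemma delta_trans_const n (i : ordcat n) : a n i = a n (ord0 : ordcat n).
Proof.
have := ncompP (a n) (leq0n i : @hom (ordcat n) ord0 i).
by rewrite /= comp_idl comp_idr.
Qed.

Program Definition delta_section_lift : section_hom x y :=
  @SectionHom H x y (fun n => a n (ord0 : ordcat n)) _.
Next Obligation.
have := cct_nat a t (ord0 : ordcat m).
by rewrite [in RHS](delta_trans_const (cc_map cordcat t (ord0 : ordcat m))).
Qed.

End DeltaSectionFull.

Lemma delta_section_full (H : ccategory) : full (delta_section H).
Proof.
move=> x y a; exists (delta_section_lift a); apply: ccat_trans_eq => n i.
exact: (esym (delta_trans_const a i)).
Qed.

(** * Extension over the cone *)

Program Definition slast n : smap n n.+1 := @Smap n n.+1 (lift ord_max) _.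
Next Obligation. by move=> i k; rewrite !lift_max. Qed.

(** [unlift ord_max] returns [None] exactly at the last vertex, so the default [ord_max] of [oapp]
    sends cone point to cone point, and [t] acts on the remaining vertices. *)
Program Definition scone m n (t : smap m n) : smap m.+1 n.+1 :=
  @Smap m.+1 n.+1
    (fun i => oapp (fun i' => lift ord_max (t i')) ord_max (unlift ord_max i)) _.
Next Obligation.
move=> i k; case: (unliftP ord_max k) => [k' ->|-> _]; last exact: leq_ord.
case: (unliftP ord_max i) => [i' ->|->]; rewrite ![oapp _ _ _]/= !lift_max.
  exact: sfun_homo.
by rewrite leqNgt ltn_ord.
Qed.

Lemma scone_lift m n (t : smap m n) (i : 'I_m.+1) :
  scone t (lift ord_max i) = lift ord_max (t i).
Proof. by rewrite /= liftK. Qed.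

Lemma scone_max m n (t : smap m n) : scone t ord_max = ord_max.
Proof. by rewrite /= unlift_none. Qed.

(** The cone on [cssimplex]: the last vertex of each simplex is the cone point,
    and all structure maps preserve it. *)
Program Definition cscone : csspace :=
  @CSSpace (fun n => simplex n.+1) (fun _ _ t => simplex_map (scone t)) _ _.
Next Obligation.
apply: sset_map_eq => m u; apply: smap_eq => i; rewrite [RHS]/=.
by rewrite -[LHS]/(scone (sid n) (u i)); case: (unliftP ord_max (u i)) => [i' ->|->];
  rewrite ?scone_lift ?scone_max.
Qed.
Next Obligation.
apply: sset_map_eq => p u0; apply: smap_eq => i.
rewrite -[LHS]/(scone (scomp t u) (u0 i)) -[RHS]/(scone t (scone u (u0 i))).
by case: (unliftP ord_max (u0 i)) => [i' ->|->]; rewrite ?scone_lift ?scone_max.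
Qed.

Program Definition cone_incl : csspace_map cssimplex cscone :=
  @CSSpaceMap cssimplex cscone (fun n => simplex_map (slast n)) _.
Next Obligation.
apply: sset_map_eq => p u; apply: smap_eq => i.
exact: (esym (scone_lift t (u i))).
Qed.

Lemma cone_incl_cof : cs_cof cone_incl.
Proof.
move=> n Z u v e; apply: sset_map_eq => m z; apply: smap_eq => i.
apply: (@lift_inj _ ord_max).
exact: (congr1 (fun h : sset_map Z (simplex n.+1) => h m z i) e).
Qed.

Lemma cone_incl_weq : cs_weq cone_incl.
Proof. by move=> n; apply: simplex_map_weq. Qed.

(** An isomorphism with inverse [ordcat_simplex]; it replaces the cosimplicial space of simplices by
    a nerve, so that the results on function complexes of nerves apply. *)
Program Definition simplex_ordcat : csspace_map cssimplex (cnerve cordcat) :=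
  @CSSpaceMap cssimplex (cnerve cordcat)
    (fun n => @SSetMap (simplex n) (nerve (ordcat n)) (fun m t => ordmap t) _) _.
Next Obligation. exact: ordmap_comp. Qed.
Next Obligation. by apply: sset_map_eq => p u; apply: ordmap_comp. Qed.

Program Definition ordcat_simplex : csspace_map (cnerve cordcat) cssimplex :=
  @CSSpaceMap (cnerve cordcat) cssimplex
    (fun n => @SSetMap (nerve (ordcat n)) (simplex n) (fun m F => smap_of F) _) _.
Next Obligation. exact: smap_eq. Qed.
Next Obligation. by apply: sset_map_eq => p u; apply: smap_eq. Qed.

Lemma simplex_ordcatK : cscomp ordcat_simplex simplex_ordcat = csid cssimplex.
Proof. by apply: csspace_map_eq => n; apply: sset_map_eq => m t; apply: ordmapK. Qed.

Lemma ordcat_simplexK : cscomp simplex_ordcat ordcat_simplex = csid (cnerve cordcat).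
Proof. by apply: csspace_map_eq => n; apply: sset_map_eq => m t; apply: smap_ofK. Qed.

Lemma stack_extension (H : cgroupoid) (E : ccat_map cordcat H) : stack H ->
  exists L : csspace_map cscone (cnerve H),
    cscomp L cone_incl = cscomp (cnerve_map E) simplex_ordcat.
Proof.
move=> sH; have [|L []] := sH _ _ _ cone_incl_cof cone_incl_weq
    (cscomp (cnerve_map E) simplex_ordcat) (to_cspt _); last by exists L.
by apply: csspace_map_eq => n; apply: sset_map_eq.
Qed.

Section ConeSection.
Variables (H : ccategory) (E : ccat_map cordcat H) (L : csspace_map cscone (cnerve H)).
Hypothesis LE : cscomp L cone_incl = cscomp (cnerve_map E) simplex_ordcat.

(** By the Yoneda lemma, level [n] of [L] amounts to its value on the identity simplex. *)
Definition cone_functor n : functor (ordcat n.+1) (H n) := L n n.+1 (sid n.+1).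

Lemma cone_functor_nat m n (t : smap m n) :
  fcomp (cone_functor n) (ordmap (scone t)) = fcomp (cc_map H t) (cone_functor m).
Proof.
have e := congr1 (fun h : sset_map (simplex m.+1) (nerve (H n)) => h _ (sid m.+1))
  (csm_nat L t).
rewrite -[RHS]e -[LHS](smap_nat (L n) (scone t) (sid n.+1)).
by congr (L n _ _); apply: smap_eq.
Qed.

Lemma cone_functor_base n : fcomp (cone_functor n) (ordmap (slast n)) = E n.
Proof.
have e := congr1 (fun h : csspace_map cssimplex (cnerve H) => h n n (sid n)) LE.
rewrite -[LHS](smap_nat (L n) (slast n) (sid n.+1)).
transitivity (L n n (scomp (slast n) (sid n))).
  by congr (L n _ _); apply: smap_eq.
by rewrite [LHS]e; apply: functor_eq.
Qed.

Definition cone_max n : ordcat n.+1 := ord_max.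
Definition cone_lift n (i : ordcat n) : ordcat n.+1 := lift ord_max i.
Definition cone_edge n (i : ordcat n) : hom (cone_lift i) (cone_max n) :=
  leq_ord (cone_lift i).

Program Definition cone_section : section_ob H :=
  @SectionOb H (fun n => cone_functor n (cone_max n)) _.
Next Obligation.
have := functor_ob (cone_max m) (cone_functor_nat t).
by rewrite -[LHS]/(cone_functor n (scone t ord_max)) scone_max.
Qed.

Definition cone_trans_at n (i : ordcat n) : hom (E n i) (cone_section n) :=
  retype (functor_ob i (cone_functor_base n)) erefl
    (fmap (cone_functor n) (cone_edge i)).

Program Definition cone_nattrans n :
    nattrans (E n) ((delta_section H cone_section : ccat_map cordcat H) n) :=
  @Nattrans (ordcat n) (H n) (E n)
    ((delta_section H cone_section : ccat_map cordcat H) n) (@cone_trans_at n) _.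
Next Obligation.
rewrite comp_idl; apply: arrow_inj; rewrite arrow_retype.
(* The edge from [x] to the cone point factors through [y]; applying the cone functor to this
   factorization is the naturality square. *)
rewrite (_ : cone_edge x = comp (cone_edge y) (fmap (ordmap (slast n)) f));
  last exact: bool_irrelevance.
rewrite fmap_comp; apply: arrow_comp; last exact: arrow_retype.
exact: (functor_arrow f (esym (cone_functor_base n))).
Qed.

Program Definition cone_trans :
    ccat_trans E (delta_section H cone_section : ccat_map cordcat H) :=
  @CCatTrans cordcat H E (delta_section H cone_section : ccat_map cordcat H)
    cone_nattrans _.
Next Obligation.
rewrite (arrow_fmap _ (arrow_retype _ _ _)) arrow_retype.
apply: etrans (esym (functor_arrow (cone_edge x) (cone_functor_nat t))) _.
(* Morphisms in an ordinal are determined by their endpoints, so it suffices that [scone t] carries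
   the base vertex and the cone point to the right places. *)
have fmap_ord (i k i' k' : ordcat n.+1) (f : hom i k) (f' : hom i' k') :
    i = i' -> k = k' ->
    Arrow (fmap (cone_functor n) f) = Arrow (fmap (cone_functor n) f').
  by move=> ei ek; subst i' k'; rewrite (bool_irrelevance f f').
by apply: fmap_ord; [apply: scone_lift|apply: scone_max].
Qed.

End ConeSection.

Lemma delta_section_equivalence (H : cgroupoid) :
  stack H -> equivalence (delta_section H).
Proof.
move=> sH.
apply: (ff_equivalence (gpd_inv (global_sections H)) (gpd_inv (delta_groupoid H))).
- exact: delta_section_full.
- exact: delta_section_faithful.
move=> E; have [L LE] := stack_extension E sH.
(* [cone_trans] points from the datum to the constant one, opposite to what essential surjectivity
   asks. *)
exists (cone_section L), (inv (gpd_inv (delta_groupoid H)) (cone_trans LE)).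
by [].
Qed.

(** * Transfer from groupoids to function complexes *)

Lemma nerve_unitcat n (s t : nerve unitcat n) : s = t.
Proof.
apply: functor_eq => [i|i j f]; first by case: (s i) (t i) => [] [].
by case: (s i) (s j) (fmap s f) (t i) (t j) (fmap t f) => [] [] [] [] [] [].
Qed.

Program Definition pt_cunit : csspace_map cspt (cnerve cunit) :=
  @CSSpaceMap cspt (cnerve cunit)
    (fun n => @SSetMap sspt (nerve unitcat)
       (fun m _ => @constf (ordcat m) unitcat tt) _) _.
Next Obligation. exact: nerve_unitcat. Qed.
Next Obligation. by apply: sset_map_eq => p u; apply: nerve_unitcat. Qed.

Lemma weq_nerve_delta (G : ccategory) :
  weq (sscomp (cshom_pre (cnerve G) simplex_ordcat) (nerve_cshom cordcat G)).
Proof.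
apply: weq_comp (cshom_pre_bij_weq _ simplex_ordcatK ordcat_simplexK) _.
exact: nerve_cshom_weq.
Qed.

Lemma weq_nerve_unit (G : ccategory) :
  weq (sscomp (cshom_pre (cnerve G) pt_cunit) (nerve_cshom cunit G)).
Proof.
apply: weq_comp (cshom_pre_bij_weq (r := to_cspt _) _ _ _) _.
- by apply: csspace_map_eq => n; apply: sset_map_eq => m [].
- by apply: csspace_map_eq => n; apply: sset_map_eq => m u; apply: nerve_unitcat.
exact: nerve_cshom_weq.
Qed.

Lemma cshom_pre_post (X Y Z W : csspace) (i : csspace_map X Y)
    (g : csspace_map Z W) :
  sscomp (cshom_post X g) (cshom_pre Z i) = sscomp (cshom_pre W i) (cshom_post Y g).
Proof.
by apply: sset_map_eq => n c; apply: csspace_map_eq => m; apply: sset_map_eq.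
Qed.

Lemma cshom_pre_comp (X Y Z W : csspace) (i : csspace_map X Y) (k : csspace_map Y Z) :
  cshom_pre W (cscomp k i) = sscomp (cshom_pre W i) (cshom_pre W k).
Proof.
by apply: sset_map_eq => n c; apply: csspace_map_eq => m; apply: sset_map_eq.
Qed.

(** The comparison of [weq_nerve_delta] is natural in the target, so the map is transferred to the
    nerve of [post_functor], which is an equivalence. *)
Lemma delta_post_weq (G H : cgroupoid) (j : ccat_map G H) :
  cg_weq j -> weq (cshom_post cssimplex (cnerve_map j)).
Proof.
move=> jw; apply: weq_cancel_right (weq_nerve_delta G) _.
rewrite sscompA cshom_pre_post -sscompA nerve_cshom_post sscompA.
apply: weq_comp (weq_nerve_delta H) _.
apply: (equivalence_weq (gpd_inv (delta_groupoid G)) (gpd_inv (delta_groupoid H))).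
exact: post_equivalence.
Qed.

(** [delta_section] is this functor after [section_functor]. Both of those are equivalences, so the
    remaining factor is obtained by cancellation. *)
Lemma to_cunit_weq (H : cgroupoid) :
  stack H -> weq (nerve_map (pre_functor H (to_cunit cordcat))).
Proof.
move=> sH; have iL := gpd_inv (global_sections H).
apply: (@weq_cancel_right _ _ _ _ (nerve_map (section_functor H))).
  apply: (equivalence_weq iL (gpd_inv (map_groupoid cunit H))).
  exact: section_equivalence.
rewrite -nerve_map_comp.
apply: (equivalence_weq iL (gpd_inv (delta_groupoid H))).
exact: delta_section_equivalence.
Qed.

Lemma section_pre_weq (H : cgroupoid) :
  stack H -> weq (cshom_pre (cnerve H) (to_cspt cssimplex)).
Proof.
move=> sH; apply: weq_cancel_right (weq_nerve_unit H) _.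
rewrite sscompA -cshom_pre_comp.
(* Both sides land in the nerve of [unitcat], where any two simplices of the same degree are
   equal. *)
have -> : cscomp pt_cunit (to_cspt cssimplex) =
    cscomp (cnerve_map (to_cunit cordcat)) simplex_ordcat.
  apply: csspace_map_eq => n; apply: sset_map_eq => m t; exact: nerve_unitcat.
rewrite cshom_pre_comp -sscompA nerve_cshom_pre sscompA.
exact: weq_comp (weq_nerve_delta H) (to_cunit_weq sH).
Qed.

Theorem mainTheorem4 (G H : cgroupoid) (j : ccat_map G H)
    (hj : stack_completion j) :
  weq (cshom_post cssimplex (cnerve_map j)) /\
  weq (cshom_pre (cnerve H) (to_cspt cssimplex)) /\
  equivalent (delta_groupoid G) (global_sections H).
Proof.
case: hj => jw sH; split; first exact: delta_post_weq.
split; first exact: section_pre_weq.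
have iG := gpd_inv (delta_groupoid G); have iH := gpd_inv (delta_groupoid H).
have iL := gpd_inv (global_sections H).
(* [delta_section] goes from the sections to the descent data of [H], so it is inverted before being
   composed with [post_functor]. *)
have [K eK _] := equivalence_inv iL iH (delta_section_equivalence sH).
exists (fcomp K (post_functor cordcat j)).
by apply: equivalence_comp eK => //; apply: post_equivalence.
Qed.
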